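(* For all $\boldsymbol z\in\boldsymbol{\mathcal Z}$ the following estimates hold: $$h^{-2}\|\boldsymbol z\|_0^2\ \lesssim\ \mathcal A_0(\boldsymbol z,\boldsymbol z)\ \lesssim\ h^{-2}\|\boldsymbol z\|_0^2,$$ and also $$[\alpha_0\beta_0+\alpha_1\beta_1]\,h^{-2}\|\boldsymbol z\|_0^2\ \lesssim\ \mathcal A(\boldsymbol z,\boldsymbol z)\ \lesssim\ [\alpha_0\beta_0+\alpha_1\beta_1]\,h^{-2}\|\boldsymbol z\|_0^2,$$ where $\beta_0=d\lambda+2\mu$, $\beta_1=2\mu$, and $\|\cdot\|_0$ is the $[L^2(\Omega)]^d$ norm.
   Context: Mesh. $\Omega\subset\mathbb R^d$, $d\in\{2,3\}$, is a polygon/polyhedron, $\partial\Omega=\Gamma_D\cup\Gamma_N$ (either part may be empty). $\mathcal T_h$ is a conforming (no hanging nodes) shape-regular partition of $\Omega$ into simplices $T$ of diameter $h_T$, and $h=\max_T h_T$. $\mathcal E_h^o$ is the set of interior faces ($(d-1)$-dimensional simplices); each boundary face belongs either to the set $\mathcal E_h^D$ of faces on $\Gamma_D$ or to the set $\mathcal E_h^N$ of faces on $\Gamma_N$. $h_E$ is the diameter of the face $E$. Each face $E$ carries a fixed unit normal $\boldsymbol n$ (outward to $\Omega$ on boundary faces); for interior $E$, $T^+$ (resp. $T^-$) is the neighbor for which $\boldsymbol n$ is outward (resp. inward). Hidden constants. $a\lesssim b$ means $a\le Cb$ with a constant $C>0$ independent of the mesh size $h$ and of $\boldsymbol z$; in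 the second estimate the dependence on $\lambda$ and $\mu$ is displayed by the explicit factor, so that $C$ is there also independent of $\lambda$ and $\mu$. In the first estimate no parameter-dependent factor is displayed. Traces. On interior faces $\{\!\{w\}\!\}=(w^++w^-)/2$ and $[\![w]\!]=w^+-w^-$, with $w^\pm$ the traces from $T^\pm$; on boundary faces $\{\!\{w\}\!\}=[\![w]\!]=w$. $\mathcal P_E^0 w=\frac1{|E|}\int_E w$ is the $L^2(E)$-projection onto constants (componentwise for vectors). Spaces. $\boldsymbol V^{DG}$ is the space of vector fields in $[L^2(\Omega)]^d$ whose restriction to each $T\in\mathcal T_h$ lies in $[\mathbb P^1(T)]^d$ (affine), and $$\boldsymbol{\mathcal Z}=\{\boldsymbol z\in\boldsymbol V^{DG}:\mathcal P^0_E\{\!\{\boldsymbol z\}\!\}=0\ \ \forall E\in\mathcal E_h^o\cup\mathcal E_h^N\}.$$ Bilinear forms. $0<\mu_1<\mu<\mu_2$ and $0\le\lambda<\infty$ are the Lamé parameters, $\mathcal C A=2\mu A+\lambda\,\mathrm{trace}(A)I$ for symmetric $A$, $\boldsymbol\varepsilon(\boldsymbol u)=\frac12(\nabla\boldsymbol u+(\nabla\boldsymbol u)^T)$ (elementwise). With $\langle\cdot:\cdot\rangle$ the Frobenius product and $\langle\cdot,\cdot\rangle$ the Euclidean product, $$\mathcal A_0(\boldsymbol u,\boldsymbol w)=\sum_{T\in\mathcal T_h}\int_T\langle\mathcal C\boldsymbol\varepsilon(\boldsymbol u):\boldsymbol\varepsilon(\boldsymbol w)\rangle-\sum_{E\in\mathcal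 E_h^o\cup\mathcal E_h^D}\int_E\Big(\langle\{\!\{(\mathcal C\boldsymbol\varepsilon(\boldsymbol u))\boldsymbol n\}\!\},[\![\boldsymbol w]\!]\rangle+\langle[\![\boldsymbol u]\!],\{\!\{(\mathcal C\boldsymbol\varepsilon(\boldsymbol w))\boldsymbol n\}\!\}\rangle\Big)+\alpha_0\beta_0\sum_{E\in\mathcal E_h^o\cup\mathcal E_h^D}h_E^{-1}\int_E\langle[\![\boldsymbol u]\!],\mathcal P_E^0[\![\boldsymbol w]\!]\rangle,$$ $$\mathcal A(\boldsymbol u,\boldsymbol w)=\mathcal A_0(\boldsymbol u,\boldsymbol w)+\alpha_1\beta_1\sum_{E\in\mathcal E_h^o\cup\mathcal E_h^D}h_E^{-1}\int_E\langle[\![\boldsymbol u]\!],[\![\boldsymbol w]\!]\rangle.$$ Standing assumption on penalties: $\alpha_1>0$, and $\alpha_0\ge1$ is chosen large enough (depending only on constants in trace and inverse inequalities) that for all $\boldsymbol v\in\boldsymbol V^{DG}$ $$\mathcal A_0(\boldsymbol v,\boldsymbol v)\ge\tfrac12\sum_{T\in\mathcal T_h}\int_T\langle\mathcal C\boldsymbol\varepsilon(\boldsymbol v):\boldsymbol\varepsilon(\boldsymbol v)\rangle+\tfrac{\alpha_0}{2}\beta_0\sum_{E\in\mathcal E_h^o\cup\mathcal E_h^D}h_E^{-1}\|\mathcal P^0_E[\![\boldsymbol v]\!]\|_{0,E}^2 .$$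
   Formalization: The two upper bounds are proved for quasi-uniform meshes (h ≤ τ h_T for all T) with constant depending on τ, since with shape regularity alone they fail for z supported on two elements much smaller than h; the lower bounds need no such assumption. *)

(* Defs.v *)
From HB Require Import structures.
From mathcomp Require Import all_boot all_order all_algebra.
From mathcomp Require Import all_classical all_reals all_analysis.

Set Implicit Arguments.
Unset Strict Implicit.
Unset Printing Implicit Defensive.

Import Order.TTheory GRing.Theory Num.Theory.
Import numFieldNormedType.Exports.

Local Open Scope classical_set_scope.
Local Open Scope ring_scope.

(* Points and vectors of R^d are row vectors.  The library norm on 'rV[R]_d is
   the sup norm, hence the explicit Euclidean norm below; the topology
   (open, closure, interior) does not depend on this choice. *)

Section Euclidean.
Context {R : realType} {d : nat}.
Implicit Types (x y u v : 'rV[R]_d) (A B : 'M[R]_d).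

Definition dot u v : R := \sum_j u 0 j * v 0 j.

Definition enorm u : R := Num.sqrt (dot u u).

Definition frob A B : R := \sum_i \sum_j A i j * B i j.

Definition diam (K : set 'rV[R]_d) : R :=
  sup [set r | exists x y, [/\ K x, K y & r = enorm (x - y)]].

(* diameter of the largest Euclidean ball contained in K *)
Definition inner_diam (K : set 'rV[R]_d) : R :=
  sup [set r | 0 <= r /\ exists c, forall x, enorm (x - c) <= r / 2 -> K x].

Definition affinely_free (I : finType) (p : I -> 'rV[R]_d) (S : {set I}) :=
  forall w : I -> R, \sum_(i in S) w i = 0 -> \sum_(i in S) w i *: p i = 0 ->
  forall i, i \in S -> w i = 0.

Definition conv_hull (I : finType) (p : I -> 'rV[R]_d) (S : {set I}) :
    set 'rV[R]_d :=
  [set x | exists w : I -> R, [/\ forall i, i \in S -> 0 <= w i,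
     \sum_(i in S) w i = 1 & x = \sum_(i in S) w i *: p i]].

Definition open_hull (I : finType) (p : I -> 'rV[R]_d) (S : {set I}) :
    set 'rV[R]_d :=
  [set x | exists w : I -> R, [/\ forall i, i \in S -> 0 < w i,
     \sum_(i in S) w i = 1 & x = \sum_(i in S) w i *: p i]].

(* Polygon (d = 2) or polyhedron (d = 3): a nonempty connected open set which
   is the interior of a finite union of nondegenerate simplices. *)
Definition polyhedral_domain (Omega : set 'rV[R]_d) : Prop :=
  [/\ Omega !=set0, connected Omega &
   exists (m : nat) (p : 'I_m -> 'I_d.+1 -> 'rV[R]_d),
     (forall k, affinely_free (p k) [set: 'I_d.+1]%SET) /\
     Omega = interior (\bigcup_(k in [set: 'I_m])
                         conv_hull (p k) [set: 'I_d.+1]%SET)].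

Definition bdry (Omega : set 'rV[R]_d) := closure Omega `\` interior Omega.

End Euclidean.

Section SimplexIntegral.
Context {R : realType}.

(* iterated Lebesgue integral of f over { t in R^k | t_j >= 0, sum_j t_j <= s } *)
Fixpoint std_simplex_int (k : nat) : R -> ('rV[R]_k -> R) -> R :=
  match k with
  | 0 => fun _ f => f 0
  | k'.+1 => fun s f =>
      \int[lebesgue_measure]_(x in `[0, s])
         std_simplex_int (s - x) (fun t : 'rV[R]_k' => f (row_mx x%:M t))
  end.

(* Integral, with respect to the k-dimensional (Lebesgue or surface) measure, of
   f over the simplex with the k+1 listed vertices: with the edge vectors from
   the first vertex as rows of B, t |-> s_0 + t B parametrizes the simplex over
   the standard one, with Jacobian factor sqrt (det (B B^T)), which is |det B|
   when k = d. *)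
Definition simplex_int d (s : seq 'rV[R]_d) (f : 'rV[R]_d -> R) : R :=
  let B := \matrix_(i < (size s).-1) (s`_i.+1 - s`_0) in
  Num.sqrt (\det (B *m B^T)) *
  std_simplex_int 1 (fun t : 'rV[R]_((size s).-1) => f (s`_0 + t *m B)).

End SimplexIntegral.

Definition beta0 (R : realType) (d : nat) (lambda mu : R) : R :=
  d%:R * lambda + 2 * mu.

Definition beta1 (R : realType) (mu : R) : R := 2 * mu.

(* An element or a face is represented by the set of its vertex indices; nrm
   gives the normal fixed on each face. *)
Record mesh (R : realType) (d : nat) := Mesh {
  nvert : nat;
  pt : 'I_nvert -> 'rV[R]_d;
  elems : {set {set 'I_nvert}};
  nrm : {set 'I_nvert} -> 'rV[R]_d }.

Section Mesh.
Context {R : realType} {d : nat} (M : mesh R d).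
Implicit Types (E T S : {set 'I_(nvert M)}).

Definition cell S : set 'rV[R]_d := conv_hull (@pt _ _ M) S.

Definition hcell S : R := diam (cell S).

Definition hmesh : R := \big[Num.max/0]_(T in elems M) hcell T.

Definition neighbors E : {set {set 'I_(nvert M)}} :=
  [set T in elems M | E \subset T]%SET.

Definition faces : {set {set 'I_(nvert M)}} :=
  [set E : {set 'I_(nvert M)} |
     (#|E| == d) && (neighbors E != finset.set0)]%SET.

Definition interior_faces : {set {set 'I_(nvert M)}} :=
  [set E in faces | (1 < #|neighbors E|)%N]%SET.

Definition boundary_faces : {set {set 'I_(nvert M)}} :=
  [set E in faces | #|neighbors E| == 1%N]%SET.

(* Relative interiors, so that the same definition works whether or not Gamma
   contains its own relative boundary. *)
Definition faces_on (Gamma : set 'rV[R]_d) : {set {set 'I_(nvert M)}} :=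
  [set E in boundary_faces |
     `[< open_hull (@pt _ _ M) E `<=` Gamma >]]%SET.

Definition outward E T : bool :=
  [forall i in T :\: E, forall j in E, dot (nrm E) (pt i - pt j) < 0].

Definition inward E T : bool :=
  [forall i in T :\: E, forall j in E, 0 < dot (nrm E) (pt i - pt j)].

(* Tplus E is the element T^+; on a boundary face, whose normal points out of
   Omega, it is the only element containing E. *)
Definition Tplus E : {set 'I_(nvert M)} :=
  odflt finset.set0 [pick T in neighbors E | outward E T].

Definition Tminus E : {set 'I_(nvert M)} :=
  odflt finset.set0 [pick T in neighbors E | inward E T].

(* conforming simplicial partition of Omega, with its normals, compatible with
   the splitting of the boundary *)
Record mesh_of (Omega GammaD GammaN : set 'rV[R]_d) : Prop := MeshOf {
  mesh_card : forall T, T \in elems M -> #|T| = d.+1;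
  mesh_free : forall T, T \in elems M -> affinely_free (@pt _ _ M) T;
  mesh_cover : closure Omega = \bigcup_(T in [set` elems M]) cell T;
  mesh_conforming : forall T T', T \in elems M -> T' \in elems M ->
    cell T `&` cell T' = cell (T :&: T');
  mesh_nrm_unit : forall E, E \in faces -> enorm (nrm E) = 1;
  mesh_nrm_ortho : forall E, E \in faces ->
    forall i j, i \in E -> j \in E -> dot (nrm E) (pt i - pt j) = 0;
  mesh_nrm_outward : forall E T, E \in boundary_faces -> T \in neighbors E ->
    outward E T;
  mesh_bdry : forall E, E \in boundary_faces ->
    (E \in faces_on GammaD) (+) (E \in faces_on GammaN) }.

Definition shape_regular (sigma : R) : Prop :=
  forall T, T \in elems M -> hcell T <= sigma * inner_diam (cell T).

Definition quasi_uniform (tau : R) : Prop :=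
  forall T, T \in elems M -> hmesh <= tau * hcell T.

Definition cell_int S (f : 'rV[R]_d -> R) : R :=
  simplex_int [seq pt i | i <- enum S] f.

(* A piecewise defined quantity is a family w indexed by the elements, w T being
   its restriction to T; affine restrictions are taken with their affine
   extension, so that the trace of w from T at a point x of its boundary is
   w T x. *)
Section Traces.
Context {V : lmodType R}.
Implicit Types w : {set 'I_(nvert M)} -> 'rV[R]_d -> V.

Definition avg w E (x : 'rV[R]_d) : V :=
  if E \in interior_faces then 2^-1 *: (w (Tplus E) x + w (Tminus E) x)
  else w (Tplus E) x.

Definition jump w E (x : 'rV[R]_d) : V :=
  if E \in interior_faces then w (Tplus E) x - w (Tminus E) x
  else w (Tplus E) x.

End Traces.

Definition proj0 E (w : 'rV[R]_d -> 'rV[R]_d) : 'rV[R]_d :=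
  \row_j ((cell_int E (fun=> 1))^-1 * cell_int E (fun x => w x 0 j)).

Definition field := {set 'I_(nvert M)} -> 'rV[R]_d -> 'rV[R]_d.
Implicit Types u w v z : field.

Definition VDG v : Prop := forall T, T \in elems M ->
  exists (G : 'M[R]_d) (b : 'rV[R]_d), forall x, v T x = x *m G + b.

Definition Zspace (GammaN : set 'rV[R]_d) z : Prop :=
  VDG z /\ forall E, E \in interior_faces :|: faces_on GammaN ->
  proj0 E (avg z E) = 0.

Definition L2norm v : R :=
  Num.sqrt (\sum_(T in elems M) cell_int T (fun x => dot (v T x) (v T x))).

Definition strain v T (x : 'rV[R]_d) : 'M[R]_d :=
  2^-1 *: (jacobian (v T) x + (jacobian (v T) x)^T).

Section Forms.
Variables (GammaD : set 'rV[R]_d) (lambda mu alpha0 alpha1 : R).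

Definition elast (A : 'M[R]_d) : 'M[R]_d :=
  (2 * mu) *: A + (lambda * \tr A) *: 1%:M.

(* (C eps(v)) n, written as a row vector *)
Definition traction v E T (x : 'rV[R]_d) : 'rV[R]_d :=
  (elast (strain v T x) *m (nrm E)^T)^T.

Definition penalty_faces := interior_faces :|: faces_on GammaD.

Definition energy u w : R := \sum_(T in elems M)
  cell_int T (fun x => frob (elast (strain u T x)) (strain w T x)).

Definition A0 u w : R :=
  energy u w
  - \sum_(E in penalty_faces) cell_int E (fun x =>
        dot (avg (traction u E) E x) (jump w E x)
      + dot (jump u E x) (avg (traction w E) E x))
  + alpha0 * beta0 d lambda mu * \sum_(E in penalty_faces) (hcell E)^-1 *
      cell_int E (fun x => dot (jump u E x) (proj0 E (jump w E))).

Definition Afull u w : R :=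
  A0 u w + alpha1 * beta1 mu * \sum_(E in penalty_faces) (hcell E)^-1 *
    cell_int E (fun x => dot (jump u E x) (jump w E x)).

(* the standing assumption that the penalty alpha0 is large enough *)
Definition stable : Prop := forall v, VDG v ->
  2^-1 * energy v v + alpha0 / 2 * beta0 d lambda mu * (\sum_(E in penalty_faces)
    (hcell E)^-1 *
      cell_int E (fun=> dot (proj0 E (jump v E)) (proj0 E (jump v E))))
  <= A0 v v.

End Forms.
End Mesh.

(* Main.v *)
Require Import Defs.
From HB Require Import structures.
From mathcomp Require Import all_boot all_order all_algebra.
From mathcomp Require Import all_classical all_reals all_analysis.
From mathcomp Require Import ring lra.

Import Order.TTheory GRing.Theory Num.Theory.
Import numFieldNormedType.Exports.

Local Open Scope classical_set_scope.
Local Open Scope ring_scope.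

(* For z in Z the averages of the two traces over an interior face E cancel, and
   the average over a Neumann face vanishes.  Hence the mean of z|_T over any
   facet of T is bounded by the mean of the jump over that facet.  An affine
   field on a simplex is determined by its means over the facets, so ||z||_T^2 is
   controlled by |T| times the squared mean jumps; as |T| <= |E| h_T / d and
   h_E <= h_T, this gives h^-2 ||z||^2 <= C sum_E h_E^-1 ||P_E^0 [[z]]||_E^2, and
   the stability assumption yields both lower bounds.

   For the upper bounds all integrals are expressed through vertex values, the
   moments of the standard simplex being known exactly.  The gradient u_i of the
   i-th barycentric coordinate satisfies |E_i| = d |T| |u_i| and
   |u_i| <= sigma / h_T, which gives the trace and inverse inequalities.  In the
   consistency terms the mean jump equals twice the mean trace, up to sign, from
   either side, so that every term involves a single element at a time. *)

Set Implicit Arguments.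
Unset Strict Implicit.
Unset Printing Implicit Defensive.

(** * Moments of simplices *)

(** All local estimates scale with [h_T], the statement with the global [h]. For the lower bounds
    [h_T <= h] suffices; the upper bounds must trade [h_T^-2] for [h^-2], and [sum_loc_L2] is the
    single place where quasi-uniformity enters. In the lower bounds the energy is merely
    nonnegative, so no Korn inequality is involved.

    To keep the constants free of the Lamé and penalty parameters, [A0] is compared with
    [alpha0 * beta0] times [h^-2 ||z||^2], and the full jump term, without its weight, with
    [h^-2 ||z||^2].

    The integrals are iterated Lebesgue integrals. Weighted sums of squares of affine functions are
    integrated in one stroke through an explicit polynomial antiderivative, which avoids linearity
    of the integral and changes of variables. *)

Lemma Rintegral_deriv_poly (R : realType) (p : {poly R}) (s : R) : 0 <= s ->
  \int[lebesgue_measure]_(x in `[0, s]) (p^`()).[x] = p.[s] - p.[0].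
Proof.
rewrite le_eqVlt => /predU1P[<-|s0].
  by rewrite set_itv1 Rintegral_set1 subrr.
rewrite /Rintegral (@continuous_FTC2 _ _ (horner p)) //.
- by apply: continuous_in_subspaceT => x _; exact: continuous_horner.
- split.
  + by move=> x _; exact: derivable_horner.
  + by apply: cvg_at_right_filter; exact: continuous_horner.
  + by apply: cvg_at_left_filter; exact: continuous_horner.
- by move=> x _; rewrite -derivE.
Qed.

(* The divided powers [y ^+ k / k`!] turn the repeated integrations by parts
   over the standard simplices into shifts of the index. *)
Definition divpow {R : realType} (k : nat) (y : R) : R := (k`!)%:R^-1 * y ^+ k.

Definition divpowp {R : realType} (k : nat) (s : R) : {poly R} :=
  ((k`!)%:R^-1)%:P * (s%:P - 'X) ^+ k.

Lemma horner_divpowp (R : realType) k (s x : R) :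
  (divpowp k s).[x] = divpow k (s - x).
Proof. by rewrite /divpowp /divpow !hornerE. Qed.

Lemma deriv_divpowp (R : realType) k (s : R) :
  (divpowp k.+1 s)^`() = - divpowp k s.
Proof.
have -> : divpowp k s = (((k.+1)`!)%:R^-1 * k.+1%:R)%:P * (s%:P - 'X) ^+ k.
  congr (_%:P * _); rewrite factS natrM invfM mulrAC mulVf ?mul1r //.
rewrite /divpowp derivM derivC mul0r add0r deriv_exp derivB derivC derivX sub0r.
by rewrite polyCM polyC_natr -mulr_natr /=; ring.
Qed.

Lemma divpow0 (R : realType) k : divpow k.+1 (0 : R) = 0.
Proof. by rewrite /divpow expr0n mulr0. Qed.

Definition sumc {R : realType} {k : nat} (l : 'cV[R]_k) : R := \sum_i l i 0.
Definition sumsqc {R : realType} {k : nat} (l : 'cV[R]_k) : R :=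
  \sum_i l i 0 ^+ 2.

(* Integral of [(c + t l) ^+ 2] over the standard simplex of size [s]. *)
Definition sq_moment {R : realType} (k : nat) (s c : R) (l : 'cV[R]_k) : R :=
  c ^+ 2 * divpow k s + 2 * c * sumc l * divpow k.+1 s
  + (sumsqc l + sumc l ^+ 2) * divpow k.+2 s.

(** Weighted sums of squares are stable under slicing: at first coordinate [x] the slice is a
    simplex of size [s - x], the constant becomes [c + a x] and [l] loses its first entry. Arbitrary
    signs in [e] later give affine functions by polarisation. *)
Lemma std_simplex_int_sq (R : realType) (I : finType) (e : I -> R) (k : nat)
    (s : R) (c : I -> R) (l : I -> 'cV[R]_k) : 0 <= s ->
  std_simplex_int s (fun t : 'rV[R]_k =>
    \sum_m e m * (c m + (t *m l m) 0 0) ^+ 2) =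
  \sum_m e m * sq_moment s (c m) (l m).
Proof.
elim: k s c l => [|k IH] s c l s0 /=.
  apply: eq_bigr => m _; congr (_ * _).
  rewrite mul0mx mxE addr0 /sq_moment /sumc /sumsqc !big_ord0 /divpow !expr0.
  by rewrite fact0 invr1 !(mulr0, mul0r, addr0, mulr1, expr0n).
(* Made opaque below: only the values and the derivative rule of [q] matter, and [ring] then sees
   atoms. *)
pose q j : {poly R} := divpowp j s.
have hq j x : (q j).[x] = divpow j (s - x) by exact: horner_divpowp.
have dq j : (q j.+1)^`() = - q j by exact: deriv_divpowp.
clearbody q.
pose a m := l m 0 0.
pose l' m : 'cV[R]_k := dsubmx (l m : 'M[R]_(1 + k, 1)).
pose u m : {poly R} := (c m)%:P + (a m)%:P * 'X.
(* Result of integrating the slice moment by parts; as [u] is affine in [x] the process stops. Every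
   term carries a [q] of positive index, so [P] vanishes at [s] and only its value at 0 survives. *)
pose P m : {poly R} := - (u m ^+ 2 * q k.+1
  + 2%:P * (a m + sumc (l' m))%:P * u m * q k.+2
  + (2 * a m ^+ 2 + 2 * sumc (l' m) * a m + (sumsqc (l' m) + sumc (l' m) ^+ 2))%:P
    * q k.+3).
have sumcE m : sumc (l m) = a m + sumc (l' m).
  rewrite /sumc big_ord_recl; congr (_ + _); apply: eq_bigr => i _.
  by rewrite mxE; congr (l m _ _); apply/val_inj.
have sumsqcE m : sumsqc (l m) = a m ^+ 2 + sumsqc (l' m).
  rewrite /sumsqc big_ord_recl; congr (_ + _); apply: eq_bigr => i _.
  by rewrite mxE; congr (l m _ _ ^+ 2); apply/val_inj.
transitivity (\int[lebesgue_measure]_(x in `[0, s])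
    ((\sum_m (e m)%:P * P m)^`()).[x]); last first.
  rewrite Rintegral_deriv_poly // !horner_sum -sumrB; apply: eq_bigr => m _.
  rewrite !hornerM !hornerC -mulrBr; congr (_ * _).
  rewrite /P /u !(hornerN, hornerD, hornerM, hornerC, hornerX, horner_exp, hq)
     subrr subr0 !divpow0.
  rewrite /sq_moment sumcE sumsqcE; ring.
apply: eq_Rintegral => x; rewrite inE /= in_itv /= => /andP[x0 xs].
have -> : (fun t : 'rV[R]_k => \sum_m e m *
    (c m + ((row_mx (x%:M : 'M[R]_1) t : 'rV[R]_(1 + k)) *m l m) 0 0) ^+ 2) =
    fun t => \sum_m e m * ((c m + a m * x) + (t *m l' m) 0 0) ^+ 2.
  apply/funext => t; apply: eq_bigr => m _; congr (_ * _ ^+ 2).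
  rewrite -[l m in LHS](@vsubmxK _ 1 k) mul_row_col mxE addrA; congr (_ + _ + _).
  rewrite mul_scalar_mx !mxE mulrC; congr (l m _ _ * _).
  exact/val_inj.
rewrite IH ?subr_ge0 // raddf_sum horner_sum; apply: eq_bigr => m _ /=.
rewrite derivM derivC mul0r add0r hornerM hornerC; congr (_ * _).
rewrite /P /u !(derivN, derivD, derivM, derivC, derivX, dq, deriv_exp).
rewrite /sq_moment !(hornerN, hornerD, hornerM, hornerC, hornerX, horner_exp, hornerMn, hq) /=; ring.
Qed.

Section SimplexMoments.
Context {R : realType} {d : nat}.
Implicit Types (s : seq 'rV[R]_d) (v : 'cV[R]_d) (b : R).

Definition edges k s : 'M[R]_(k, d) := \matrix_(i < k) (s`_i.+1 - s`_0).

(* [k`!] times the k-dimensional measure of the simplex spanned by [s]. *)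
Definition gvol k s : R := Num.sqrt (\det (edges k s *m (edges k s)^T)).

Definition aff v b (x : 'rV[R]_d) : R := (x *m v) 0 0 + b.

Lemma simplex_intE k s f : size s = k.+1 ->
  simplex_int s f =
  gvol k s * std_simplex_int 1 (fun t : 'rV[R]_k => f (s`_0 + t *m edges k s)).
Proof. by move=> sk; rewrite /simplex_int /gvol /edges sk. Qed.

Lemma sum_vertices k s (F : 'rV[R]_d -> R) : size s = k.+1 ->
  \sum_(x <- s) F x = F s`_0 + \sum_(i < k) F s`_i.+1.
Proof. by move=> sk; rewrite (big_nth 0) sk big_mkord big_ord_recl. Qed.

Lemma affB v b x y : aff v b x - aff v b y = ((x - y) *m v) 0 0.
Proof. by rewrite /aff mulmxBl !mxE; ring. Qed.

(** [sq_moment] singles out the first vertex; written in the vertex values [c] and [c + l i] it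
    becomes symmetric. This is what turns integrals into vertex sums everywhere below. *)
Lemma simplex_int_sq (I : finType) (e : I -> R) (v : I -> 'cV[R]_d)
    (b : I -> R) k s : size s = k.+1 ->
  simplex_int s (fun x => \sum_m e m * aff (v m) (b m) x ^+ 2) =
  gvol k s / (k.+2)`!%:R * \sum_m e m *
    (\sum_(x <- s) aff (v m) (b m) x ^+ 2 +
     (\sum_(x <- s) aff (v m) (b m) x) ^+ 2).
Proof.
move=> sk; rewrite (simplex_intE _ sk) -mulrA; congr (_ * _).
pose c m := aff (v m) (b m) s`_0.
pose l m := edges k s *m v m.
have -> : (fun t : 'rV[R]_k => \sum_m e m *
    aff (v m) (b m) (s`_0 + t *m edges k s) ^+ 2) =
    fun t => \sum_m e m * (c m + (t *m l m) 0 0) ^+ 2.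
  apply/funext => t; apply: eq_bigr => m _; congr (_ * _ ^+ 2).
  by rewrite /c /aff /l mulmxA mulmxDl !mxE; ring.
have lE m (i : 'I_k) : aff (v m) (b m) s`_i.+1 = c m + l m i 0.
  rewrite -[LHS](subrK (c m)) affB addrC; congr (_ + _).
  rewrite /l [LHS]mxE [RHS]mxE; apply: eq_bigr => j _.
  by rewrite [edges _ _ _ _]mxE.
rewrite std_simplex_int_sq // mulr_sumr; apply: eq_bigr => m _.
rewrite !(sum_vertices _ sk) -/(c m) mulrCA; congr (_ * _).
have -> : \sum_(i < k) aff (v m) (b m) s`_i.+1 = \sum_(i < k) (c m + l m i 0).
  by apply: eq_bigr => i _; rewrite lE.
have -> : \sum_(i < k) aff (v m) (b m) s`_i.+1 ^+ 2 =
    \sum_(i < k) (c m + l m i 0) ^+ 2.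
  by apply: eq_bigr => i _; rewrite lE.
rewrite big_split /= -/(sumc (l m)) sumr_const card_ord.
have -> : \sum_(i < k) (c m + l m i 0) ^+ 2 =
    k%:R * c m ^+ 2 + 2 * c m * sumc (l m) + sumsqc (l m).
  rewrite /sumc /sumsqc mulr_sumr -[k in k%:R]card_ord -sumr_const mulr_suml.
  rewrite -!big_split /=; apply: eq_bigr => i _; ring.
rewrite /sq_moment /divpow !expr1n !factS !natrM -[k.+2%:R]natr1 -[k.+1%:R]natr1.
rewrite -mulr_natr.
have k0 : k`!%:R != 0 :> R by rewrite pnatr_eq0 -lt0n fact_gt0.
have k1 : k%:R + 1 != 0 :> R by rewrite natr1 pnatr_eq0.
have k2 : k%:R + 1 + 1 != 0 :> R by rewrite !natr1 pnatr_eq0.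
by field; rewrite ?k0 ?k1 ?k2.
Qed.

Lemma simplex_int_cst c k s : size s = k.+1 ->
  simplex_int s (fun=> c) = gvol k s / k`!%:R * c.
Proof.
move=> sk; have -> : (fun=> c) = fun x => \sum_(m : 'I_1) c * aff 0 1 x ^+ 2.
  by apply/funext => x; rewrite big_ord1 /aff mulmx0 mxE add0r expr1n mulr1.
rewrite (simplex_int_sq _ _ _ sk) big_ord1.
have sum1 : \sum_(x <- s) 1 = k%:R + 1 :> R.
  by rewrite big_const_seq count_predT sk iter_addr_0 natr1.
have aff1 x : aff 0 1 x = 1 by rewrite /aff mulmx0 mxE add0r.
have -> : \sum_(x <- s) aff 0 1 x = k%:R + 1.
  by rewrite -sum1; apply: eq_bigr => x _; exact: aff1.
have -> : \sum_(x <- s) aff 0 1 x ^+ 2 = k%:R + 1.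
  by rewrite -sum1; apply: eq_bigr => x _; rewrite aff1 expr1n.
rewrite !factS !natrM -[k.+2%:R]natr1 -[k.+1%:R]natr1.
have k0 : k`!%:R != 0 :> R by rewrite pnatr_eq0 -lt0n fact_gt0.
have k1 : k%:R + 1 != 0 :> R by rewrite natr1 pnatr_eq0.
have k2 : k%:R + 1 + 1 != 0 :> R by rewrite !natr1 pnatr_eq0.
by field; rewrite ?k0 ?k1 ?k2.
Qed.

Lemma simplex_int_aff v b k s : size s = k.+1 ->
  simplex_int s (aff v b) = gvol k s / k.+1`!%:R * \sum_(x <- s) aff v b x.
Proof.
(* Polarisation: [f = ((f + 1)^2 - (f - 1)^2) / 4] is a signed sum of squares. *)
move=> sk; have affE : aff v b = fun x => \sum_(m : bool)
    (if m then 4^-1 else - 4^-1) * aff v (if m then b + 1 else b - 1) x ^+ 2.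
  by apply/funext => x; rewrite big_bool /aff /=; field.
rewrite [in LHS]affE (simplex_int_sq _ _ _ sk) big_bool /=.
have affD e x : aff v (b + e) x = aff v b x + e by rewrite /aff addrA.
have sumE e : \sum_(x <- s) aff v (b + e) x =
    \sum_(x <- s) aff v b x + (k%:R + 1) * e.
  rewrite (eq_bigr _ (fun x _ => affD e x)) big_split /= big_const_seq.
  by rewrite count_predT sk iter_addr_0 natr1 mulr_natl.
have sumsqE e : \sum_(x <- s) aff v (b + e) x ^+ 2 =
    \sum_(x <- s) aff v b x ^+ 2 + 2 * e * \sum_(x <- s) aff v b x
    + (k%:R + 1) * e ^+ 2.
  have -> : (k%:R + 1) * e ^+ 2 = \sum_(x <- s) e ^+ 2.
    by rewrite big_const_seq count_predT sk iter_addr_0 natr1 mulr_natl.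
  rewrite mulr_sumr -!big_split /=; apply: eq_bigr => x _; rewrite affD; ring.
rewrite !sumE !sumsqE !factS !natrM -[k.+2%:R]natr1 -[k.+1%:R]natr1.
have k0 : k`!%:R != 0 :> R by rewrite pnatr_eq0 -lt0n fact_gt0.
have k1 : k%:R + 1 != 0 :> R by rewrite natr1 pnatr_eq0.
have k2 : k%:R + 1 + 1 != 0 :> R by rewrite !natr1 pnatr_eq0.
by field; rewrite ?k0 ?k1 ?k2.
Qed.
End SimplexMoments.

(** * Euclidean geometry of simplices *)

Section DotProduct.
Context {R : realType} {d : nat}.
Implicit Types (u v w : 'rV[R]_d).

Lemma dotE u v : dot u v = (u *m v^T) 0 0.
Proof. by rewrite mxE; apply: eq_bigr => j _; rewrite mxE. Qed.

Lemma dotC u v : dot u v = dot v u.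
Proof. by apply: eq_bigr => j _; rewrite mulrC. Qed.

Lemma dotDl u v w : dot (u + v) w = dot u w + dot v w.
Proof. by rewrite !dotE mulmxDl mxE. Qed.

Lemma dotZl a u v : dot (a *: u) v = a * dot u v.
Proof. by rewrite !dotE -scalemxAl mxE. Qed.

Lemma dotNl u v : dot (- u) v = - dot u v.
Proof. by rewrite -scaleN1r dotZl mulN1r. Qed.

Lemma dotBl u v w : dot (u - v) w = dot u w - dot v w.
Proof. by rewrite dotDl dotNl. Qed.

Lemma dotDr u v w : dot w (u + v) = dot w u + dot w v.
Proof. by rewrite dotC dotDl !(dotC w). Qed.

Lemma dotZr a u v : dot u (a *: v) = a * dot u v.
Proof. by rewrite dotC dotZl dotC. Qed.

Lemma dotNr u v : dot u (- v) = - dot u v.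
Proof. by rewrite dotC dotNl dotC. Qed.

Lemma dotBr u v w : dot w (u - v) = dot w u - dot w v.
Proof. by rewrite dotDr dotNr. Qed.

Lemma dot0r u : dot u 0 = 0.
Proof. by rewrite -[0](scale0r (0 : 'rV[R]_d)) dotZr mul0r. Qed.

Lemma dot_sumr (I : Type) (r : seq I) (P : pred I) (F : I -> 'rV[R]_d) u :
  dot u (\sum_(i <- r | P i) F i) = \sum_(i <- r | P i) dot u (F i).
Proof. exact: (big_morph (dot u) (fun x y => dotDr x y u) (dot0r u)). Qed.

Lemma dot_ge0 u : 0 <= dot u u.
Proof. by apply: sumr_ge0 => j _; rewrite -expr2 sqr_ge0. Qed.

Lemma dot_eq0 u : (dot u u == 0) = (u == 0).
Proof.
apply/eqP/eqP => [/eqP|->]; last exact: dot0r.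
rewrite psumr_eq0 => [/allP u0|j _]; last by rewrite -expr2 sqr_ge0.
apply/rowP => j; rewrite mxE.
by have := u0 j (mem_index_enum _); rewrite mulf_eq0 orbb => /eqP.
Qed.

Lemma dot_CS u v : dot u v ^+ 2 <= dot u u * dot v v.
Proof.
have [->|v0] := eqVneq v 0; first by rewrite !dot0r expr0n mulr0.
have vv : 0 < dot v v by rewrite lt_def dot_ge0 dot_eq0 v0.
have := dot_ge0 (dot v v *: u - dot u v *: v).
rewrite !(dotBl, dotBr, dotZl, dotZr) (dotC v u) => h.
have : 0 <= dot v v * (dot u u * dot v v - dot u v ^+ 2) by nra.
by rewrite pmulr_rge0 // subr_ge0.
Qed.

Lemma enorm_ge0 u : 0 <= enorm u. Proof. exact: sqrtr_ge0. Qed.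

Lemma sqr_enorm u : enorm u ^+ 2 = dot u u.
Proof. by rewrite sqr_sqrtr ?dot_ge0. Qed.

Lemma dot_le_enorm u v : dot u v <= enorm u * enorm v.
Proof.
rewrite (le_trans (ler_norm _)) // -ler_sqr ?nnegrE ?mulr_ge0 ?enorm_ge0 //.
by rewrite real_normK ?num_real // exprMn !sqr_enorm dot_CS.
Qed.

Lemma dot_sumsq (I : finType) (S : {set I}) (F : I -> 'rV[R]_d) :
  dot (\sum_(i in S) F i) (\sum_(i in S) F i) <=
  #|S|%:R * \sum_(i in S) dot (F i) (F i).
Proof.
have AM i j : 2 * dot (F i) (F j) <= dot (F i) (F i) + dot (F j) (F j).
  have := dot_ge0 (F i - F j); rewrite !(dotBl, dotBr) (dotC (F j) (F i)); lra.
rewrite -(@ler_pM2l _ 2) // dot_sumr mulr_sumr.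
under eq_bigr do rewrite dotC dot_sumr mulr_sumr.
apply: (@le_trans _ _ (\sum_(i in S) \sum_(j in S)
    (dot (F i) (F i) + dot (F j) (F j)))).
  by apply: ler_sum => i _; apply: ler_sum => j _; exact: AM.
under eq_bigr do rewrite big_split /= sumr_const.
rewrite big_split /= sumr_const sumrMnl -[_ *+ #|S|]mulr_natl.
by rewrite le_eqVlt; apply/orP; left; apply/eqP; ring.
Qed.

End DotProduct.

(** * Integrals over simplices given by vertex sets *)

Section SetSimplex.
Context {R : realType} {d : nat} {I : finType} (p : I -> 'rV[R]_d).
Implicit Types (S : {set I}).

(** Leaving out the factor [1 / (#|S|.-1)!] of the measure removes the dimension factor from the
    pyramid formula; the factorials reappear in the constants. *)
Definition svol S : R := gvol #|S|.-1 [seq p i | i <- enum S].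

Definition sint S (f : 'rV[R]_d -> R) : R :=
  simplex_int [seq p i | i <- enum S] f.

Definition affine_field (w : 'rV[R]_d -> 'rV[R]_d) :=
  exists (G : 'M[R]_d) (b : 'rV[R]_d), forall x, w x = x *m G + b.

Lemma size_vertices S : (0 < #|S|)%N ->
  size [seq p i | i <- enum S] = (#|S|.-1).+1.
Proof. by move=> S0; rewrite size_map -cardE prednK. Qed.

Lemma svol_ge0 S : 0 <= svol S.
Proof. exact: sqrtr_ge0. Qed.

Lemma sint_cst S c : (0 < #|S|)%N ->
  sint S (fun=> c) = svol S / (#|S|.-1)`!%:R * c.
Proof. by move=> S0; rewrite /sint (simplex_int_cst _ (size_vertices S0)). Qed.

Lemma sint_coord S w j : (0 < #|S|)%N -> affine_field w ->
  sint S (fun x => w x 0 j) =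
  svol S / (#|S|)`!%:R * (\sum_(i in S) w (p i)) 0 j.
Proof.
move=> S0 [G [b wE]].
have -> : (fun x => w x 0 j) = aff (col j G) (b 0 j).
  apply/funext => x; rewrite wE /aff mxE; congr (_ + _).
  by rewrite !mxE; apply: eq_bigr => k _; rewrite mxE.
rewrite /sint (simplex_int_aff _ _ (size_vertices S0)) prednK //.
congr (_ * _); rewrite big_map big_enum summxE; apply: eq_bigr => i _ /=.
rewrite wE /aff [in RHS]mxE; congr (_ + _).
by rewrite !mxE; apply: eq_bigr => k _; rewrite mxE.
Qed.

Lemma sint_dot S w c : (0 < #|S|)%N -> affine_field w ->
  sint S (fun x => dot c (w x)) =
  svol S / (#|S|)`!%:R * dot c (\sum_(i in S) w (p i)).
Proof.
move=> S0 [G [b wE]].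
have affE x : dot c (w x) = aff (G *m c^T) (dot c b) x.
  by rewrite wE dotDr /aff; congr (_ + _); rewrite dotC dotE mulmxA.
have -> : (fun x => dot c (w x)) = aff (G *m c^T) (dot c b) by exact/funext.
rewrite /sint (simplex_int_aff _ _ (size_vertices S0)) prednK //.
congr (_ * _); rewrite big_map big_enum dot_sumr; apply: eq_bigr => i _ /=.
by rewrite affE.
Qed.

Lemma sint_sqnorm S w : (0 < #|S|)%N -> affine_field w ->
  sint S (fun x => dot (w x) (w x)) =
  svol S / (#|S|.+1)`!%:R * (\sum_(i in S) dot (w (p i)) (w (p i)) +
    dot (\sum_(i in S) w (p i)) (\sum_(i in S) w (p i))).
Proof.
move=> S0 [G [b wE]].
have affE x j : w x 0 j = aff (col j G) (b 0 j) x.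
  rewrite wE /aff mxE; congr (_ + _).
  by rewrite !mxE; apply: eq_bigr => k _; rewrite mxE.
have -> : (fun x => dot (w x) (w x)) =
    fun x => \sum_j 1 * aff (col j G) (b 0 j) x ^+ 2.
  by apply/funext => x; apply: eq_bigr => j _; rewrite mul1r affE -expr2.
rewrite /sint (simplex_int_sq _ _ _ (size_vertices S0)) prednK //.
congr (_ * _); rewrite exchange_big /= -big_split; apply: eq_bigr => j _ /=.
rewrite mul1r !big_map !big_enum /=; congr (_ + _).
  by apply: eq_bigr => i _; rewrite -affE expr2.
rewrite summxE -expr2; congr (_ ^+ 2); apply: eq_bigr => i _; exact/esym/affE.
Qed.
End SetSimplex.

(** [bump] is the shift behind [lift] and [row'], so removing a vertex from the enumeration becomes
    deleting a row of the edge matrix. *)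
Lemma nth_rem (T : eqType) (x0 x : T) (s : seq T) j : x \in s ->
  nth x0 (rem x s) j = nth x0 s (bump (index x s) j).
Proof.
move=> xs; rewrite remE nth_cat size_takel ?index_size // /bump.
case: ltnP => ji; first by rewrite nth_take // leqNgt ji.
by rewrite nth_drop addSn subnKC // leq_eqVlt ltnS orbC addnC addn1.
Qed.

Lemma enum_setD1 (I : finType) (S : {set I}) (i : I) :
  enum (S :\ i)%SET = rem i (enum S).
Proof.
rewrite rem_filter ?enum_uniq // {1}/enum_mem -filter_predI.
by apply: eq_filter => j; rewrite /= !inE andbC.
Qed.

(** * Facet volumes and barycentric gradients *)

Section GramVolume.
Context {R : realType} {n : nat}.
Implicit Types (s : seq 'rV[R]_n.+1).

(** The Gram matrix of the facet is a principal submatrix of [G = B B^T]. Its determinant is a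
    diagonal entry of the adjugate, that is [det G] times the entry [q q] of [G^-1], and the latter
    is the squared norm of column [q] of [B^-1]. Only facets containing the base vertex are reached
    this way. *)
Lemma gvol_facet (q : 'I_n.+1) s s' :
  edges n.+1 s \in unitmx -> edges n s' = row' q (edges n.+1 s) ->
  gvol n s' = gvol n.+1 s * enorm (col q (invmx (edges n.+1 s)))^T.
Proof.
set B := edges n.+1 s => Bu s'E.
rewrite /gvol s'E -/B; set G := B *m B^T.
have -> : row' q B *m (row' q B)^T = row' q (col' q G).
  apply/matrixP => i j; rewrite !mxE; apply: eq_bigr => k _.
  by rewrite !mxE.
have detG : \det G = \det B ^+ 2 by rewrite det_mulmx det_tr expr2.
have Gu : G \in unitmx by rewrite unitmx_mul unitmx_tr Bu.
have -> : \det (row' q (col' q G)) = (\adj G) q q.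
  by rewrite !mxE /cofactor -signr_odd addnn odd_double mul1r.
have -> : \adj G = \det G *: invmx G.
  rewrite /invmx Gu scalerA divrr ?scale1r //.
have -> : invmx G = (invmx B)^T *m invmx B.
  apply: (can_inj (mulKmx Gu)); rewrite mulmxV // mulmxA -(mulmxA B).
  by rewrite -trmx_mul mulVmx // trmx1 mulmx1 mulmxV.
rewrite mxE sqrtrM ?detG ?sqr_ge0 //; congr (_ * Num.sqrt _).
by rewrite mxE; apply: eq_bigr => k _; rewrite !mxE.
Qed.

(** Exchanging the first two vertices changes the base vertex and brings the one remaining facet
    into the scope of [gvol_facet]. The new edges are [- e_0] and [e_i - e_0], hence a lower
    triangular matrix with diagonal [-1, 1, ..., 1]. *)
Lemma edges_swap (x y : 'rV[R]_n.+1) s :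
  exists2 P : 'M[R]_n.+1, \det P = -1 &
  edges n.+1 (y :: x :: s) = P *m edges n.+1 (x :: y :: s).
Proof.
exists (\matrix_(i, j) ((i == j)%:R *+ (i != 0) - (j == 0)%:R)).
  rewrite det_trig.
    rewrite big_ord_recl big1 ?mulr1 => [|i _]; last first.
      by rewrite !mxE eqxx /= subr0.
    by rewrite mxE eqxx /= sub0r.
  apply/is_trig_mxP => i j ij; rewrite mxE.
  have [j0|j0] := eqVneq j 0; first by rewrite j0 in ij.
  by rewrite -val_eqE ltn_eqF // mul0rn subrr.
apply/row_matrixP => i; rewrite row_mul rowK mulmx_sum_row.
pose e j := row j (edges n.+1 (x :: y :: s)).
have eE j : e j = (x :: y :: s)`_j.+1 - x by rewrite /e rowK.
rewrite (eq_bigr (fun j => ((i == j)%:R *+ (i != 0)) *: e j - (j == 0)%:R *: e j));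
  last by move=> j _; rewrite !mxE scalerBl.
rewrite sumrB (bigD1 i) //= big1 ?addr0 => [|j /negPf ji]; last first.
  by rewrite eq_sym ji mul0rn scale0r.
rewrite (bigD1 (0 : 'I_n.+1)) //= big1 ?addr0 => [|j /negPf ->]; last first.
  by rewrite scale0r.
rewrite !eE eqxx scale1r /=; case: (unliftP 0 i) => [k ->|->] /=.
  by rewrite scale1r opprB addrA subrK.
by rewrite scale0r sub0r opprB.
Qed.

Lemma gvol_swap (x y : 'rV[R]_n.+1) s :
  gvol n.+1 (y :: x :: s) = gvol n.+1 (x :: y :: s).
Proof.
rewrite /gvol; have [P dP ->] := edges_swap x y s; rewrite trmx_mul mulmxA -(mulmxA P).
by rewrite 2!det_mulmx det_tr dP; congr Num.sqrt; ring.
Qed.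
End GramVolume.

Section Barycentric.
Context {R : realType} {n : nat} {I : finType} (p : I -> 'rV[R]_n.+1).
Context (T : {set I}) (cardT : #|T| = n.+2) (freeT : affinely_free p T).

(** The entries of [y] weight the vertices other than the base, which takes the rest of the total
    [c]. With [c = 0] a kernel vector of the edge matrix becomes an affine dependence; with [c = 1]
    these are barycentric coordinates. *)
Lemma edge_weights (c : R) (y : 'rV[R]_n.+1) :
  exists w : I -> R, [/\ \sum_(i in T) w i = c,
    \sum_(i in T) w i *: p i = c *: [seq p i | i <- enum T]`_0
      + y *m edges n.+1 [seq p i | i <- enum T] &
    (forall i, i \in T -> w i = 0) -> y = 0].
Proof.
have szT : size (enum T) = n.+2 by rewrite -cardE.
have [i0 [t' tE]] : exists i0 t', enum T = i0 :: t'.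
  by case: (enum T) szT => [|i0 t'] // _; exists i0, t'.
(* Outside [T] the index is [n.+2] and [inord] returns a default, which no sum over [T] sees. *)
pose w i := if index i (enum T) is q.+1 then y 0 (inord q) else c - \sum_j y 0 j.
have sumT (V : zmodType) (F : I -> V) : \sum_(i in T) F i =
    F i0 + \sum_(j < n.+1) F (nth i0 (enum T) j.+1).
  rewrite -big_enum (big_nth i0) szT big_mkord big_ord_recl /=.
  by rewrite {1}tE /=.
have w0 : w i0 = c - \sum_j y 0 j by rewrite /w tE /= eqxx.
have wS (j : 'I_n.+1) : w (nth i0 (enum T) j.+1) = y 0 j.
  have jT : (j.+1 < size (enum T))%N by rewrite szT ltnS ltn_ord.
  by rewrite /w (index_uniq _ jT (enum_uniq _)) inord_val.
exists w; split.
- by rewrite sumT w0 [X in _ + X](eq_bigr _ (fun j _ => wS j)) subrK.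
- have s0 : [seq p i | i <- enum T]`_0 = p i0 by rewrite tE.
  rewrite sumT w0 mulmx_sum_row s0.
  rewrite (eq_bigr (fun j : 'I_n.+1 => y 0 j *: p (nth i0 (enum T) j.+1)));
    last by move=> j _; rewrite wS.
  rewrite scalerBl -addrA scaler_suml; congr (_ + _).
  rewrite addrC -sumrB; apply: eq_bigr => j _.
  rewrite rowK s0 (nth_map i0) ?scalerBr //.
  by rewrite szT ltnS ltn_ord.
- move=> wT; apply/rowP => j; rewrite -wS wT ?mxE //.
  by rewrite -mem_enum mem_nth // szT ltnS ltn_ord.
Qed.

Lemma edges_unit : edges n.+1 [seq p i | i <- enum T] \in unitmx.
Proof.
rewrite -row_free_unit -kermx_eq0; apply/eqP/row_matrixP => i.
rewrite row0; have /sub_kermxP := row_sub i (kermx (edges n.+1 [seq p i | i <- enum T])).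
set y := row i _ => yB.
have [w [w1 w2 w3]] := edge_weights 0 y.
by apply: w3; apply: freeT => //; rewrite w2 scale0r add0r yB.
Qed.

Lemma bary_exists (x : 'rV[R]_n.+1) :
  exists w : I -> R, \sum_(i in T) w i = 1 /\ x = \sum_(i in T) w i *: p i.
Proof.
set s := [seq p i | i <- enum T].
have [w [w1 w2 _]] := edge_weights 1 ((x - s`_0) *m invmx (edges n.+1 s)).
exists w; split => //; rewrite w2 -/s mulmxKV ?edges_unit // scale1r.
by rewrite addrC subrK.
Qed.

Lemma svol_gt0 : 0 < svol p T.
Proof.
rewrite /svol cardT /= /gvol sqrtr_gt0 det_mulmx det_tr -expr2.
by rewrite exprn_even_gt0 //= -unitfE -unitmxE edges_unit.
Qed.

(* [u] is the gradient of the barycentric coordinate of the vertex [i]; its norm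
   is the inverse of the height over the opposite facet, so the last equation is
   the usual volume formula for pyramids. *)
Lemma facet_gradient i : i \in T -> exists u : 'rV[R]_n.+1,
  (forall j, j \in T -> j != i -> dot u (p i - p j) = 1) /\
  svol p (T :\ i)%SET = svol p T * enorm u.
Proof.
move=> iT; have szT : size (enum T) = n.+2 by rewrite -cardE.
have cardE1 : #|T :\ i|%SET = n.+1 by have := cardsD1 i T; rewrite iT cardT => -[].
have iE : i \in enum T by rewrite mem_enum.
have szR : size (rem i (enum T)) = n.+1 by rewrite size_rem // szT.
rewrite /svol cardE1 cardT enum_setD1 /=.
(* The columns of the inverse edge matrix are dual to the edges from the base vertex; column [q] is
   the wanted gradient when edge [q] ends at [i]. *)
have grad (B : 'M[R]_n.+1) (q j : 'I_n.+1) : B \in unitmx ->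
    dot (col q (invmx B))^T (row j B) = (j == q)%:R.
  move=> Bu; rewrite dotC dotE trmxK.
  have -> : (row j B *m col q (invmx B)) 0 0 = (B *m invmx B) j q.
    by rewrite [RHS]mxE [LHS]mxE; apply: eq_bigr => k _; rewrite !mxE.
  by rewrite mulmxV // mxE.
suff [t [q [ut memt tq Bu [volt rowt]]]] : exists (t : seq I) (q : 'I_n.+1),
    [/\ size t = n.+2, t =i T, nth i t q.+1 = i,
      edges n.+1 [seq p i | i <- t] \in unitmx &
      gvol n.+1 [seq p i | i <- t] = gvol n.+1 [seq p i | i <- enum T] /\
      edges n [seq p j | j <- rem i (enum T)] =
        row' q (edges n.+1 [seq p i | i <- t])].
  set B := edges n.+1 [seq p i | i <- t] in Bu rowt.
  exists (col q (invmx B))^T; split; last first.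
    by rewrite (gvol_facet Bu rowt) volt.
  move=> j; rewrite -memt => jt ji.
  have rowE (m : 'I_n.+1) : row m B = p (nth i t m.+1) - p (nth i t 0).
    by rewrite rowK !(nth_map i) ?ut // ltnS.
  have jE := nth_index i jt.
  have jlt : (index j t < n.+2)%N by rewrite -ut index_mem.
  case: (index j t) jE jlt => [|m] jE mlt.
    by rewrite -tq -jE -rowE grad ?eqxx.
  rewrite ltnS in mlt.
  have -> : p i - p j = row q B - row (Ordinal mlt) B.
    by rewrite !rowE tq jE opprB addrA subrK.
  rewrite dotBr !grad // eqxx; case: eqVneq => [mq|_]; last by rewrite subr0.
  by case/eqP: ji; rewrite -jE -[RHS]tq -mq.
have row'E m (q : 'I_n.+1) j (B : 'M[R]_(n.+1, m)) :
    row j (row' q B) = row (lift q j) B by apply/rowP => k; rewrite !mxE.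
have := index_mem i (enum T); rewrite iE szT.
(* The order [t] must not start with [i]: if [i] comes first it is exchanged with the second vertex,
   otherwise the enumeration of [T] serves. *)
case qE : (index i (enum T)) => [|q] qlt.
  case tE : (enum T) szT qE => [|i0 [|j0 t]] // [szt] /=.
  case: eqP => // i0E _; subst i0; exists [:: j0, i & t], 0; split => //=.
  - by rewrite szt.
  - by move=> k; rewrite -[RHS]mem_enum tE !inE orbCA.
  - have [P dP ->] := edges_swap (p i) (p j0) [seq p k | k <- t].
    rewrite unitmx_mul unitmxE dP unitrN1 /=.
    by have := edges_unit; rewrite tE.
  - split; first exact: gvol_swap.
    apply/row_matrixP => j; rewrite rowK row'E !rowK.
    by rewrite lift0.
rewrite ltnS in qlt.
exists (enum T), (Ordinal qlt); split => //=.
- by move=> k; rewrite mem_enum.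
- by rewrite -qE nth_index.
- exact: edges_unit.
split => //; apply/row_matrixP => j; rewrite row'E !rowK.
rewrite !(nth_map i) ?szT ?szR // ?ltnS //;
  last by rewrite -ltnS ltn_ord.
by rewrite !nth_rem // qE /bump /= addnS.
Qed.
End Barycentric.

(** * Diameters, inscribed balls and shape regularity *)

Section HullMetric.
Context {R : realType} {d : nat} {I : finType} (p : I -> 'rV[R]_d).
Implicit Types (S T : {set I}).

Lemma enormZ (a : R) (u : 'rV[R]_d) : 0 <= a -> enorm (a *: u) = a * enorm u.
Proof.
move=> a0; rewrite /enorm dotZl dotZr mulrA -expr2 sqrtrM ?sqr_ge0 //.
by rewrite sqrtr_sqr ger0_norm.
Qed.

Lemma mem_conv_hull S i : i \in S -> conv_hull p S (p i).
Proof.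
move=> iS; exists (fun j => (j == i)%:R); split => //.
  by rewrite (bigD1 i) //= eqxx big1 ?addr0 // => j /andP[_ /negPf ->].
rewrite (bigD1 i) //= eqxx scale1r big1 ?addr0 // => j /andP[_ /negPf ->].
by rewrite scale0r.
Qed.

Lemma big_sub_support (V : nmodType) S T (F : I -> V) : S \subset T ->
  (forall i, i \notin S -> F i = 0) -> \sum_(i in T) F i = \sum_(i in S) F i.
Proof.
move=> ST F0; rewrite (big_setID S) /= (finset.setIidPr ST) [X in _ + X]big1 ?addr0 //.
by move=> i; rewrite inE => /andP[/F0].
Qed.

Lemma conv_hullS S T : S \subset T -> conv_hull p S `<=` conv_hull p T.
Proof.
move=> ST x [w [w0 w1 ->]]; exists (fun i => if i \in S then w i else 0); split.
- by move=> i _; case: ifP => // /w0.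
- rewrite (big_sub_support ST) => [|i /negPf -> //].
  by rewrite -w1; apply: eq_bigr => i ->.
- rewrite (big_sub_support ST) => [|i /negPf ->]; last by rewrite scale0r.
  by apply: eq_bigr => i ->.
Qed.

Lemma hull_weight_le1 S (w : I -> R) i : (forall j, j \in S -> 0 <= w j) ->
  \sum_(j in S) w j = 1 -> i \in S -> w i <= 1.
Proof.
move=> w0 w1 iS; rewrite -w1 (bigD1 i) //= lerDl; apply: sumr_ge0 => j.
by case/andP => /w0.
Qed.

(** [diam] is a [sup], usable only on bounded sets. Two hull points differ by weights in [-1, 1] on
    the vertices, so Cauchy-Schwarz gives a bound. *)
Lemma diam_set_ub S : has_ubound [set r | exists x y,
  [/\ conv_hull p S x, conv_hull p S y & r = enorm (x - y)]].
Proof.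
exists (Num.sqrt (#|S|%:R * \sum_(i in S) dot (p i) (p i))).
move=> r [x [y [[w [w0 w1 ->]] [v [v0 v1 ->]] ->]]].
rewrite /enorm ler_sqrt ?mulr_ge0 ?sumr_ge0 // => [|i _]; last exact: dot_ge0.
rewrite -sumrB (eq_bigr (fun i => (w i - v i) *: p i)); last first.
  by move=> i _; rewrite scalerBl.
apply: le_trans (dot_sumsq _ _) _; apply: ler_wpM2l => //.
apply: ler_sum => i iS; rewrite dotZl dotZr mulrA ler_piMl ?dot_ge0 //.
have := w0 _ iS; have := v0 _ iS.
have := hull_weight_le1 w0 w1 iS; have := hull_weight_le1 v0 v1 iS; nra.
Qed.

Lemma le_diam S x y : conv_hull p S x -> conv_hull p S y ->
  enorm (x - y) <= diam (conv_hull p S).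
Proof. by move=> Sx Sy; apply: (ub_le_sup (diam_set_ub S)); exists x, y. Qed.

Lemma diam_ge0 S : 0 <= diam (conv_hull p S).
Proof.
have [[x Sx]|/nonemptyPn S0] := pselect (conv_hull p S !=set0).
  by apply: le_trans (enorm_ge0 (x - x)) (le_diam Sx Sx).
rewrite /diam (_ : [set _ | _] = set0) ?sup0 //.
by apply/seteqP; split => // r [x [y []]]; rewrite S0.
Qed.

Lemma diamS S T : S \subset T -> S != finset.set0 ->
  diam (conv_hull p S) <= diam (conv_hull p T).
Proof.
move=> ST /finset.set0Pn[i iS]; apply: ge_sup.
  by exists (enorm (p i - p i)), (p i), (p i); split => //; exact: mem_conv_hull.
by move=> r [x [y [Sx Sy ->]]]; apply: le_diam; exact: (conv_hullS ST).
Qed.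

Section Gradient.
Context (T : {set I}) (i : I) (u : 'rV[R]_d) (iT : i \in T).
Context (uP : forall j, j \in T -> j != i -> dot u (p i - p j) = 1).

Lemma grad_delta j : j \in T -> dot u (p j) = dot u (p i) - 1 + (j == i)%:R.
Proof.
move=> jT; have [->|ji] := eqVneq j i; first by rewrite subrK.
by have := uP jT ji; rewrite dotBr addr0 => h; lra.
Qed.

Lemma grad_edge j : j \in T -> j != i -> 1 <= enorm u * enorm (p i - p j).
Proof. by move=> jT ji; rewrite -(uP jT ji) dot_le_enorm. Qed.

(** Up to a constant [dot u] is the barycentric coordinate of [i], which ranges in [0, 1] over the
    hull. *)
Lemma grad_hull x y : conv_hull p T x -> conv_hull p T y -> dot u (x - y) <= 1.
Proof.
have wE w : \sum_(j in T) w j = 1 ->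
    dot u (\sum_(j in T) w j *: p j) = dot u (p i) - 1 + w i.
  move=> w1; rewrite dot_sumr.
  rewrite (eq_bigr (fun j => w j * (dot u (p i) - 1) + w j * (j == i)%:R)).
    rewrite big_split /= -mulr_suml w1 mul1r; congr (_ + _).
    rewrite (bigD1 i) //= eqxx mulr1 big1 ?addr0 // => j /andP[_ /negPf ->].
    by rewrite mulr0.
  by move=> j jT; rewrite dotZr grad_delta // mulrDr.
move=> [w [w0 w1 ->]] [v [v0 v1 ->]]; rewrite dotBr !wE //.
have := hull_weight_le1 w0 w1 iT; have := v0 _ iT; lra.
Qed.

(** Along the diameter parallel to [u] of an inscribed ball the barycentric coordinate grows by
    [r |u|], and it can grow by at most 1. *)
Lemma inner_diam_grad : 0 < enorm u ->
  0 <= inner_diam (conv_hull p T) /\ inner_diam (conv_hull p T) * enorm u <= 1.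
Proof.
move=> u0.
have ub : ubound [set r | 0 <= r /\ exists c, forall x : 'rV[R]_d,
    enorm (x - c) <= r / 2 -> conv_hull p T x] (enorm u)^-1.
  move=> r [r0 [c cP]]; set a := r / 2 / enorm u.
  have a0 : 0 <= a by rewrite !divr_ge0 // ltW.
  have aE : a * enorm u = r / 2 by rewrite divfK ?gt_eqF.
  have xp : conv_hull p T (c + a *: u).
    by apply: cP; rewrite addrC addKr enormZ // aE.
  have xm : conv_hull p T (c - a *: u).
    apply: cP; rewrite addrC addKr -scalerN enormZ // -scaleN1r.
    by rewrite /enorm dotZl dotZr mulrA mulrNN !mulr1 mul1r -/(enorm u) aE.
  have := grad_hull xp xm; rewrite opprB addrC addrA subrK -scalerDl dotZr.
  rewrite -sqr_enorm expr2 mulrA mulrDl aE => h.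
  by rewrite -[leRHS]mul1r ler_pdivlMr //; apply: le_trans h; lra.
(* The ball of diameter 0 at a vertex keeps the set nonempty, so its [sup] is nonnegative and
   [ge_sup] applies. *)
have mem0 : [set r | 0 <= r /\ exists c, forall x : 'rV[R]_d,
    enorm (x - c) <= r / 2 -> conv_hull p T x] 0.
  split => //; exists (p i) => x; rewrite mul0r => xi.
  have : enorm (x - p i) == 0 by rewrite eq_le xi enorm_ge0.
  rewrite sqrtr_eq0 => xi0; have : dot (x - p i) (x - p i) == 0.
    by rewrite eq_le xi0 dot_ge0.
  by rewrite dot_eq0 subr_eq0 => /eqP ->; exact: mem_conv_hull.
split; first by apply: ub_le_sup mem0; exists (enorm u)^-1.
rewrite -ler_pdivlMr // div1r; apply: ge_sup; last exact: ub.
by exists 0.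
Qed.
End Gradient.
End HullMetric.

Lemma mulmxr_continuous (R : realType) (d : nat) (G : 'M[R]_d) :
  continuous (fun x : 'rV[R]_d => x *m G).
Proof.
have -> : (fun x : 'rV[R]_d => x *m G) =
    \sum_(i < d) (fun y : 'rV[R]_d => y 0 i *: row i G).
  by apply/funext => x; rewrite mulmx_sum_row fct_sumE.
move=> x; apply/differentiable_continuous/differentiable_sum => i.
exact/differentiableZl/differentiable_coord.
Qed.

Lemma jacobian_affine (R : realType) (d : nat) (G : 'M[R]_d) (b x : 'rV[R]_d) :
  jacobian (fun y : 'rV[R]_d => y *m G + b) x = G.
Proof.
have cG : continuous (mulmxr G : 'rV[R]_d -> 'rV[R]_d) by exact: mulmxr_continuous.
rewrite /jacobian; apply/row_matrixP => i; rewrite !rowE mul_rV_lin1.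
have -> : (fun y : 'rV[R]_d => y *m G + b) = (mulmxr G : 'rV[R]_d -> 'rV[R]_d) + cst b.
  by apply/funext.
rewrite diffD //; last exact: linear_differentiable.
have d1 : ('d (mulmxr G : 'rV[R]_d -> 'rV[R]_d) x : 'rV[R]_d -> 'rV[R]_d) = mulmxr G.
  exact: diff_lin.
have d2 : ('d (cst b : 'rV[R]_d -> 'rV[R]_d) x : 'rV[R]_d -> 'rV[R]_d) = 0.
  exact: diff_cst.
rewrite -[RHS]addr0.
exact: (congr2 +%R (congr1 (fun h => h _) d1) (congr1 (fun h => h _) d2)).
Qed.

Section LocalEstimates.
Context {R : realType} {n : nat} {I : finType} (p : I -> 'rV[R]_n.+1).
Context (T : {set I}) (cardT : #|T| = n.+2) (freeT : affinely_free p T).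

Local Notation hull S := (conv_hull p S).

Definition shape_ok (sigma : R) := diam (hull T) <= sigma * inner_diam (hull T).

Lemma card_facet i : i \in T -> #|(T :\ i)%SET| = n.+1.
Proof.
by move=> iT; apply/eqP; rewrite -eqSS -cardT (cardsD1 i T) iT add1n.
Qed.

(** Along an edge from [i] the coordinate changes by 1, whence [1 <= |u_i| h_T]; the upper bound
    combines [inner_diam_grad] with shape regularity. It is squared because [sigma] has no sign
    hypothesis. *)
Lemma gradients : exists u : I -> 'rV[R]_n.+1, forall i, i \in T ->
  [/\ forall j, j \in T -> j != i -> dot (u i) (p i - p j) = 1,
     svol p (T :\ i)%SET = svol p T * enorm (u i),
     0 < enorm (u i),
     1 <= enorm (u i) * diam (hull T) &
     forall sigma, shape_ok sigma ->
       (enorm (u i) * diam (hull T)) ^+ 2 <= sigma ^+ 2].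
Proof.
have /choice[u uP] : forall i, exists u, i \in T ->
    (forall j, j \in T -> j != i -> dot u (p i - p j) = 1) /\
    svol p (T :\ i)%SET = svol p T * enorm u.
  move=> i; case: (boolP (i \in T)) => iT; last by exists 0.
  by have [u uP] := facet_gradient cardT freeT iT; exists u.
exists u => i iT; have [gP vP] := uP i iT.
have [j jT ji] : exists2 j, j \in T & j != i.
  have : (0 < #|(T :\ i)%SET|)%N by rewrite (card_facet iT).
  by case/card_gt0P => j; rewrite !inE => /andP[ji jT]; exists j.
have e1 := grad_edge gP jT ji.
have dij := le_diam (mem_conv_hull p iT) (mem_conv_hull p jT).
have u0 : 0 < enorm (u i).
  rewrite lt_def enorm_ge0 andbT; apply: contraTneq e1 => ->.
  by rewrite mul0r ler10.
split => //; first by apply: le_trans e1 _; rewrite ler_pM2l.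
move=> sigma shT; have [r0 r1] := inner_diam_grad iT gP u0.
have h0 := diam_ge0 p T.
have r2 : 0 <= inner_diam (hull T) * enorm (u i) by rewrite mulr_ge0 // ltW.
have le1 : enorm (u i) * diam (hull T) <= sigma * (inner_diam (hull T) * enorm (u i)).
  by rewrite mulrA mulrC ler_pM2r.
have ge0 : 0 <= enorm (u i) * diam (hull T) by rewrite mulr_ge0 // ltW.
apply: (@le_trans _ _ ((sigma * (inner_diam (hull T) * enorm (u i))) ^+ 2)).
  by rewrite ler_sqr // nnegrE // (le_trans ge0).
rewrite exprMn ler_piMr ?sqr_ge0 // expr_le1 //.
Qed.

Lemma diam_gt0 : 0 < diam (hull T).
Proof.
have [u uP] := gradients.
have /card_gt0P[i iT] : (0 < #|T|)%N by rewrite cardT.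
have [_ _ u0 u1 _] := uP i iT.
by rewrite -(pmulr_rgt0 _ u0); apply: lt_le_trans u1.
Qed.

(** Up to factorials this is [|T| / h_T^2 <= |E| / h_E], the comparison of weights behind the lower
    bound. It rests on [h_E <= h_T] and [1 <= |u_i| h_T], without shape regularity. *)
Lemma facet_vol_lower i : i \in T ->
  svol p T * diam (hull (T :\ i)%SET) <= svol p (T :\ i)%SET * diam (hull T) ^+ 2.
Proof.
move=> iT; have [u uP] := gradients; have [_ -> u0 u1 _] := uP i iT.
rewrite -mulrA ler_pM2l ?svol_gt0 // expr2 mulrA.
have h0 := diam_ge0 p T.
apply: (@le_trans _ _ (diam (hull T))); last by rewrite ler_peMl.
apply: diamS; first exact: subsetDl.
by rewrite -card_gt0 (card_facet iT).
Qed.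

(** For [d >= 2] a facet has two vertices, and the edge joining them bounds [h_E] from below. In
    dimension one faces are points of diameter 0. *)
Lemma facet_diam_grad i : (0 < n)%N -> i \in T -> exists2 j, j \in T &
  forall u, (forall k, k \in T -> k != j -> dot u (p j - p k) = 1) ->
  1 <= enorm u * diam (hull (T :\ i)%SET).
Proof.
move=> n0 iT; have : (1 < #|(T :\ i)%SET|)%N by rewrite (card_facet iT).
case/card_gt1P => j [k [jE kE jk]]; exists j; first by move: jE; rewrite inE => /andP[].
move=> u uP; have [_ kT] : k != i /\ k \in T by move: kE; rewrite !inE => /andP[].
apply: le_trans (grad_edge uP kT _) _; first by rewrite eq_sym.
apply: ler_wpM2l; first exact: enorm_ge0.
by apply: le_diam; exact: mem_conv_hull.
Qed.

(** Two gradients enter, that of [i] through [|E|] and that of a vertex [j] of the facet through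
    [h_E]. The product of [|u_i| h_T] and [|u_j| h_T] is at most [sigma ^+ 2] by the
    arithmetic-geometric mean. *)
Lemma facet_vol_upper sigma i : (0 < n)%N -> shape_ok sigma -> i \in T ->
  0 < diam (hull (T :\ i)%SET) /\
  svol p (T :\ i)%SET * diam (hull T) ^+ 2 <=
  sigma ^+ 2 * diam (hull (T :\ i)%SET) * svol p T.
Proof.
move=> n0 sh iT; have [u uP] := gradients; have [_ -> u0 u1 /(_ _ sh) us] := uP i iT.
have [j jT /(_ (u j))] := facet_diam_grad n0 iT.
have [jP _ v0 v1 /(_ _ sh) vs] := uP j jT => /(_ jP).
set hE := diam _ => hE1.
have hE0 : 0 < hE by rewrite -(pmulr_rgt0 _ v0); apply: lt_le_trans hE1.
split=> //; rewrite -mulrA [leRHS]mulrC ler_pM2l ?svol_gt0 //.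
have h0 := diam_ge0 p T.
have le_s : (enorm (u i) * diam (hull T)) * (enorm (u j) * diam (hull T)) <= sigma ^+ 2.
  set a := _ * _ in us *; set b := _ * _ in vs *.
  by have := sqr_ge0 (a - b); nra.
apply: (@le_trans _ _ ((enorm (u i) * diam (hull T)) *
    (enorm (u j) * diam (hull T)) * hE)); last by rewrite ler_pM2r.
set h := diam (hull T) in h0 *; set g := enorm (u i) in u0 *.
have -> : g * h * (enorm (u j) * h) * hE = g * h ^+ 2 * (enorm (u j) * hE) by ring.
by rewrite ler_peMr // mulr_ge0 ?sqr_ge0 // ltW.
Qed.

(** Only the square of [a = |u_i| h_T] is bounded by [sigma ^+ 2]; [a <= 1 + a ^+ 2] yields the
    constant. *)
Lemma facet_vol_height sigma i : shape_ok sigma -> i \in T ->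
  svol p (T :\ i)%SET * diam (hull T) <= (1 + sigma ^+ 2) * svol p T.
Proof.
move=> sh iT; have [u uP] := gradients; have [_ -> u0 u1 /(_ _ sh) us] := uP i iT.
rewrite -mulrA [leRHS]mulrC ler_pM2l ?svol_gt0 //.
set a := _ * _ in us *; have := sqr_ge0 (a - 1); nra.
Qed.

Lemma inverse_ineq sigma (G : 'M[R]_n.+1) (b : 'rV[R]_n.+1) : shape_ok sigma ->
  diam (hull T) ^+ 2 * frob G G <= n.+2%:R * sigma ^+ 2 *
    \sum_(i in T) dot (p i *m G + b) (p i *m G + b).
Proof.
move=> sh; have [u uP] := gradients; pose z i := p i *m G + b.
(* The gradient of an affine field is the sum of the [u_i^T z_i]. The discrepancy [D] sends all
   vertices, hence by barycentric coordinates all points, to one vector, which [x = 0] shows to be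
   zero. *)
pose D := G - \sum_(i in T) (u i)^T *m z i.
have pD j : j \in T -> p j *m D = - b - \sum_(i in T) (dot (u i) (p i) - 1) *: z i.
  move=> jT; rewrite mulmxBr mulmx_sumr.
  have -> : \sum_(i in T) p j *m ((u i)^T *m z i) =
      z j + \sum_(i in T) (dot (u i) (p i) - 1) *: z i.
    rewrite (eq_bigr (fun i => (j == i)%:R *: z i + (dot (u i) (p i) - 1) *: z i)).
      rewrite big_split /=; congr (_ + _).
      rewrite (bigD1 j) //= eqxx scale1r big1 ?addr0 // => i /andP[_].
      by rewrite eq_sym => /negPf ->; rewrite scale0r.
    move=> i iT; have [gP _ _ _ _] := uP i iT.
    rewrite mulmxA [p j *m _]mx11_scalar -dotE dotC (grad_delta gP jT).
    by rewrite mul_scalar_mx scalerDl addrC.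
  by rewrite /z; set X := \sum_(i in T) _; rewrite !opprD addrA addrA subrr add0r.
move: pD; set K := - b - _ => pD.
have constD x : x *m D = K.
  have [w [w1 ->]] := bary_exists cardT freeT x.
  rewrite mulmx_suml -[RHS]scale1r -w1 scaler_suml; apply: eq_bigr => j jT.
  by rewrite -scalemxAl pD.
have D0 : D = 0.
  apply/row_matrixP => i; rewrite row0 rowE constD -(constD 0).
  exact: mul0mx.
have GE k : row k G = \sum_(i in T) u i 0 k *: z i.
  have -> : G = \sum_(i in T) (u i)^T *m z i by apply/eqP; rewrite -subr_eq0; apply/eqP.
  rewrite raddf_sum; apply: eq_bigr => i _ /=.
  apply/rowP => l; rewrite !mxE big_ord1 !mxE //.
have frobE : frob G G = \sum_k dot (row k G) (row k G).
  by apply: eq_bigr => k _; apply: eq_bigr => l _; rewrite mxE.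
apply: (@le_trans _ _ (diam (hull T) ^+ 2 *
    (n.+2%:R * \sum_(i in T) dot (u i) (u i) * dot (z i) (z i)))).
  apply: ler_wpM2l; first exact: sqr_ge0.
  rewrite frobE (_ : \sum_(i in T) _ =
      \sum_k \sum_(i in T) u i 0 k ^+ 2 * dot (z i) (z i)).
    rewrite mulr_sumr; apply: ler_sum => k _; rewrite GE -cardT.
    apply: le_trans (dot_sumsq _ _) _; rewrite le_eqVlt; apply/orP; left.
    by apply/eqP; congr (_ * _); apply: eq_bigr => i _; rewrite dotZl dotZr mulrA.
  rewrite exchange_big /=; apply: eq_bigr => i _; rewrite mulr_suml.
  by apply: eq_bigr.
rewrite mulrCA -mulrA ler_pM2l ?ltr0n // !mulr_sumr; apply: ler_sum => i iT.
rewrite mulrA; apply: ler_wpM2r; first exact: dot_ge0.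
have [_ _ _ _ /(_ _ sh)] := uP i iT.
by rewrite exprMn sqr_enorm mulrC.
Qed.
End LocalEstimates.

(** * Neighbours of a face *)

Section MeshGeometry.
Context {R : realType} {n : nat} (M : mesh R n.+1).
Context (Omega GammaD GammaN : set 'rV[R]_n.+1).
Context (HM : mesh_of M Omega GammaD GammaN).
Implicit Types (E T : {set 'I_(nvert M)}).

Lemma nb_elems E T : T \in neighbors E -> T \in elems M.
Proof. by rewrite inE => /andP[]. Qed.

Lemma apex E T : E \in faces M -> T \in neighbors E ->
  exists2 i, i \in T & E = (T :\ i)%SET.
Proof.
rewrite inE => /andP[/eqP cE _]; rewrite inE => /andP[TM ET].
have cT := mesh_card HM TM.
have /cards1P[i iE] : #|(T :\: E)%SET| == 1%N.
  by rewrite cardsD (finset.setIidPr ET) cT cE subSnn.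
have : i \in (T :\: E)%SET by rewrite iE inE.
rewrite inE => /andP[iNE iT]; exists i => //.
by rewrite -iE finset.setDDr finset.setDv finset.set0U (finset.setIidPr ET).
Qed.

Lemma face_card E : E \in faces M -> #|E| = n.+1.
Proof. by rewrite inE => /andP[/eqP]. Qed.

Lemma face_mem E : E \in faces M -> exists j, j \in E.
Proof. by move=> /face_card cE; apply/card_gt0P; rewrite cE. Qed.

Lemma facet_face T i : T \in elems M -> i \in T ->
  (T :\ i)%SET \in faces M /\ T \in neighbors (T :\ i)%SET.
Proof.
move=> TM iT; have nb : T \in neighbors (T :\ i)%SET by rewrite inE TM subsetDl.
split=> //; rewrite inE; apply/andP; split; last by apply/finset.set0Pn; exists T.
by rewrite (card_facet (mesh_card HM TM) iT).
Qed.

Section Apex.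
Context (E T : {set 'I_(nvert M)}) (i j : 'I_(nvert M)).
Context (EF : E \in faces M) (TM : T \in elems M) (iT : i \in T)
  (ETi : E = (T :\ i)%SET) (jE : j \in E).

Lemma height_indep k : k \in E ->
  dot (nrm E) (pt i - pt k) = dot (nrm E) (pt i - pt j).
Proof.
move=> kE; have := mesh_nrm_ortho HM EF kE jE; rewrite !dotBr => h; lra.
Qed.

(** Were the apex in the hyperplane of [E], barycentric coordinates would make [dot (nrm E)]
    constant on the whole space, against the unit length of the normal. *)
Lemma height_neq0 : dot (nrm E) (pt i - pt j) != 0.
Proof.
apply/eqP => h0; have dotx x : dot (nrm E) x = dot (nrm E) (pt j).
  have [w [w1 ->]] := bary_exists (mesh_card HM TM) (mesh_free HM TM) x.
  rewrite dot_sumr -[RHS]mul1r -w1 mulr_suml; apply: eq_bigr => k kT.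
  rewrite dotZr; congr (_ * _); have [->|ki] := eqVneq k i.
    by move: h0; rewrite dotBr => h; lra.
  have kE : k \in E by rewrite ETi !inE ki.
  by have := mesh_nrm_ortho HM EF kE jE; rewrite dotBr => h; lra.
have := mesh_nrm_unit HM EF; rewrite /enorm dotx -(dotx 0) dot0r sqrtr0.
by move/eqP; rewrite eq_sym oner_eq0.
Qed.

Lemma outwardE : outward E T = (dot (nrm E) (pt i - pt j) < 0).
Proof.
have TE : (T :\: E)%SET = [set i]%SET.
  by rewrite ETi finset.setDDr finset.setDv finset.set0U; apply/finset.setIidPr; rewrite finset.sub1set.
apply/forall_inP/idP => [/(_ i) | h k].
  by rewrite TE inE eqxx => /(_ isT)/forall_inP/(_ j jE).
by rewrite TE inE => /eqP ->; apply/forall_inP => l /height_indep ->.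
Qed.

Lemma inwardE : inward E T = (0 < dot (nrm E) (pt i - pt j)).
Proof.
have TE : (T :\: E)%SET = [set i]%SET.
  by rewrite ETi finset.setDDr finset.setDv finset.set0U; apply/finset.setIidPr; rewrite finset.sub1set.
apply/forall_inP/idP => [/(_ i) | h k].
  by rewrite TE inE eqxx => /(_ isT)/forall_inP/(_ j jE).
by rewrite TE inE => /eqP ->; apply/forall_inP => l /height_indep ->.
Qed.

Lemma outwardN_inward : ~~ outward E T = inward E T.
Proof. by rewrite outwardE inwardE -leNgt lt_def height_neq0. Qed.
End Apex.

(* Two elements on the same side of a common face overlap beyond it: a point
   slightly off the barycenter of [E] towards the apex of one lies in both. *)
Lemma same_side_eq E T1 T2 i1 i2 j : E \in faces M ->
  T1 \in elems M -> T2 \in elems M -> i1 \in T1 -> i2 \in T2 ->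
  E = (T1 :\ i1)%SET -> E = (T2 :\ i2)%SET -> j \in E ->
  0 < dot (nrm E) (pt i1 - pt j) * dot (nrm E) (pt i2 - pt j) -> T1 = T2.
Proof.
move=> EF T1M T2M i1T i2T E1 E2 jE same.
have [i12|i12] := eqVneq i1 i2.
  by rewrite -(finset.setD1K i1T) -(finset.setD1K i2T) -E1 -E2 i12.
exfalso.
have wlt (a b : R) : 0 <= b -> 0 < a * b -> 0 < a.
  rewrite le_eqVlt => /predU1P[<-|b0]; first by rewrite mulr0 ltxx.
  by rewrite pmulr_lgt0.
(* Coordinates of the first apex in [T2]. Its height over [E] comes from the weight of [i2] alone,
   which is therefore positive. *)
have [w [w1 i1E]] := bary_exists (mesh_card HM T2M) (mesh_free HM T2M) (pt i1).
have dotS (S : {set 'I_(nvert M)}) (v : 'I_(nvert M) -> R) :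
    \sum_(k in S) v k = 1 -> dot (nrm E) (\sum_(k in S) v k *: pt k - pt j) =
    \sum_(k in S) v k * dot (nrm E) (pt k - pt j).
  move=> v1; rewrite dotBr dot_sumr -[dot _ (pt j)]mul1r -v1 mulr_suml -sumrB.
  by apply: eq_bigr => k _; rewrite dotZr dotBr mulrBr.
have sumE0 (v : 'I_(nvert M) -> R) :
    \sum_(k in E) v k * dot (nrm E) (pt k - pt j) = 0.
  by apply: big1 => k kE; rewrite (mesh_nrm_ortho HM EF kE jE) mulr0.
have wi2 : dot (nrm E) (pt i1 - pt j) = w i2 * dot (nrm E) (pt i2 - pt j).
  by rewrite {1}i1E dotS // (big_setD1 i2 i2T) /= -E2 sumE0 addr0.
have w2 : 0 < w i2.
  by move: same; rewrite wi2 -mulrA -expr2 => same; apply: wlt same; exact: sqr_ge0.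
pose c : R := n.+1%:R^-1; have c0 : 0 < c by rewrite invr_gt0 ltr0n.
pose W := \sum_(k in E) `|w k|; have W0 : 0 <= W by apply: sumr_ge0.
have wW k : k \in E -> `|w k| <= W.
  by move=> kE; rewrite /W (bigD1 k) //= lerDl sumr_ge0.
(* Chosen so that [(1 - t) * c = t * W]: the weights [(1 - t) * c + t * w k] of [x] in [T2] are then
   nonnegative even where [w k] is negative. *)
pose t := c / (c + W).
have cW : 0 < c + W by rewrite ltr_wpDr.
have t0 : 0 < t by rewrite divr_gt0.
have tcW : t * (c + W) = c by rewrite divfK ?gt_eqF.
have t1 : t <= 1 by rewrite ler_pdivrMr // mul1r lerDl.
have sumc : \sum_(k in E) (1 - t) * c = 1 - t.
  by rewrite sumr_const (face_card EF) -mulr_natr -mulrA mulVf ?mulr1.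
pose x := \sum_(k in E) ((1 - t) * c) *: pt k + t *: pt i1.
have x1 : cell T1 x.
  exists (fun k => if k == i1 then t else (1 - t) * c); split.
  - by move=> k _; case: ifP => _; [exact: ltW|rewrite mulr_ge0 ?subr_ge0 // ltW].
  - rewrite (big_setD1 i1 i1T) /= ?eqxx -E1 -[RHS](subrK t) addrC; congr (_ + _).
    rewrite -[RHS]sumc; apply: eq_bigr => k; rewrite E1 !inE => /andP[/negPf -> //].
  - rewrite (big_setD1 i1 i1T) /= ?eqxx -E1 addrC; congr (_ + _).
    apply: eq_bigr => k; rewrite E1 !inE => /andP[/negPf -> //].
have tw : t * w i2 + t * \sum_(k in E) w k = t.
  by rewrite E2 -mulrDr -big_setD1 // w1 mulr1.
have x2 : cell T2 x.
  exists (fun k => if k == i2 then t * w k else (1 - t) * c + t * w k); split.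
  - move=> k kT; case: ifP => [/eqP ->|/negbT ki]; first by rewrite mulr_ge0 // ltW.
    have := wW k; rewrite E2 !inE ki kT => /(_ isT); rewrite ler_norml => /andP[h _].
    have -> : (1 - t) * c = t * W.
      by rewrite mulrBl mul1r -{1}tcW mulrDr addrAC subrr add0r.
    by rewrite -mulrDr mulr_ge0 ?(ltW t0) // -lerBlDl sub0r.
  - rewrite (big_setD1 i2 i2T) /= ?eqxx -E2 -[RHS](subrK t) -[X in _ = _ + X]tw.
    rewrite addrCA; congr (_ + _).
    rewrite -[X in _ = X + _]sumc mulr_sumr -big_split /=; apply: eq_bigr => k.
    by rewrite E2 !inE => /andP[/negPf -> //].
  - rewrite (big_setD1 i2 i2T) /= ?eqxx -E2 /x i1E [in LHS](big_setD1 i2 i2T) /= -E2.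
    rewrite scalerDr scalerA addrCA; congr (_ + _).
    rewrite scaler_sumr -big_split /=; apply: eq_bigr => k.
    by rewrite E2 !inE => /andP[/negPf -> _]; rewrite scalerDl scalerA.
have capE : (T1 :&: T2)%SET = E.
  apply/finset.setP => k; rewrite inE [in RHS]E1 !inE.
  have [->|ki1] := eqVneq k i1.
    rewrite i1T /=; apply/negbTE/negP => i1T2.
    have : i1 \in E by rewrite E2 !inE i12.
    by rewrite E1 !inE eqxx.
  case kT1 : (k \in T1) => //=.
  by have : k \in E by [rewrite E1 !inE ki1]; rewrite E2 inE => /andP[].
(* Conformity forces [x] into [E], at height 0, whereas its height is [t] times that of the first
   apex. *)
have : cell E x by rewrite -capE -(mesh_conforming HM T1M T2M); split.
move=> [v [_ v1 xE]].
have : dot (nrm E) (x - pt j) = 0 by rewrite xE dotS.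
have -> : x - pt j = (1 - t) *: (\sum_(k in E) c *: pt k - pt j) + t *: (pt i1 - pt j).
  rewrite /x !scalerBr scaler_sumr.
  rewrite (eq_bigr (fun k => (1 - t) *: (c *: pt k))); last first.
    by move=> k _; rewrite scalerA.
  by set X := \sum_(k in E) _; apply/rowP => l; rewrite !mxE; ring.
rewrite dotDr !dotZr dotS ?sumE0; last first.
  by rewrite sumr_const (face_card EF) -mulr_natr mulVf // pnatr_eq0.
rewrite mulr0 add0r => /eqP; rewrite mulf_eq0 (gt_eqF t0) /=.
by apply/negP; apply: contraTneq same => ->; rewrite mul0r ltxx.
Qed.
End MeshGeometry.

Section MeshFaces.
Context {R : realType} {n : nat} (M : mesh R n.+1).
Context (Omega GammaD GammaN : set 'rV[R]_n.+1).
Context (HM : mesh_of M Omega GammaD GammaN).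
Implicit Types (E T : {set 'I_(nvert M)}).

Lemma nb_outward_inj E T1 T2 : E \in faces M -> T1 \in neighbors E ->
  T2 \in neighbors E -> outward E T1 = outward E T2 -> T1 = T2.
Proof.
move=> EF T1n T2n.
have [i1 i1T E1] := apex HM EF T1n; have [i2 i2T E2] := apex HM EF T2n.
have [j jE] := face_mem EF.
have T1M := nb_elems T1n; have T2M := nb_elems T2n.
rewrite (outwardE HM EF i1T E1 jE) (outwardE HM EF i2T E2 jE) => same.
apply: (same_side_eq HM EF T1M T2M i1T i2T E1 E2 jE).
have := height_neq0 HM EF T1M E1 jE; have := height_neq0 HM EF T2M E2 jE.
by rewrite !neq_lt -same; case: ltP => //= h1 h2 h3; [rewrite nmulr_rgt0 // -same|rewrite pmulr_rgt0].
Qed.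

(** Each side of a face holds at most one neighbour. Two distinct neighbours thus occupy both sides,
    which excludes the empty-set defaults of [Tplus] and [Tminus] and leaves no room for a third. *)
Lemma interior_face E : E \in interior_faces M ->
  [/\ E \in faces M, Tplus E \in neighbors E, Tminus E \in neighbors E,
     Tplus E != Tminus E & neighbors E = [set Tplus E; Tminus E]%SET].
Proof.
rewrite inE => /andP[EF /card_gt1P[T1 [T2 [T1n T2n T12]]]].
have outin T : T \in neighbors E -> inward E T = ~~ outward E T.
  move=> Tn; have [i iT Ei] := apex HM EF Tn; have [j jE] := face_mem EF.
  by rewrite (outwardN_inward HM EF (nb_elems Tn) iT Ei jE).
have out12 : outward E T1 != outward E T2.
  by apply: contraNneq T12 => /(nb_outward_inj EF T1n T2n) ->.
have [Tpn Tpo] : Tplus E \in neighbors E /\ outward E (Tplus E).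
  rewrite /Tplus; case: pickP => [T /andP[] //|none] /=.
  have := none T1; have := none T2; rewrite T1n T2n /= => o2 o1.
  by rewrite o1 o2 in out12.
have [Tmn Tmo] : Tminus E \in neighbors E /\ ~~ outward E (Tminus E).
  rewrite /Tminus; case: pickP => [T /andP[Tn]|none] /=.
    by rewrite outin.
  have := none T1; have := none T2; rewrite T1n T2n /= !outin // => o2 o1.
  by case: (outward E T1) (outward E T2) out12 o1 o2 => [] [].
split=> //; first by apply: contraTneq Tpo => ->.
apply/finset.setP => T; rewrite finset.in_set2; apply/idP/orP => [Tn|[]/eqP -> //].
have [ho|ho] := boolP (outward E T); [left|right]; apply/eqP.
  by apply: (nb_outward_inj EF Tn Tpn); rewrite ho Tpo.
by apply: (nb_outward_inj EF Tn Tmn); rewrite (negPf ho) (negPf Tmo).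
Qed.

Lemma boundary_face E : E \in boundary_faces M ->
  [/\ E \in faces M, E \notin interior_faces M, Tplus E \in neighbors E &
     neighbors E = [set Tplus E]%SET].
Proof.
move=> EB; have := EB; rewrite inE => /andP[EF nb1].
have [T nbE] := cards1P nb1.
have Tn : T \in neighbors E by rewrite nbE inE.
have -> : Tplus E = T.
  rewrite /Tplus; case: pickP => [T' /andP[]|/(_ T)] /=.
    by rewrite nbE inE => /eqP.
  by rewrite Tn (mesh_nrm_outward HM EB Tn).
by split => //; rewrite inE EF (eqP nb1).
Qed.

Lemma penalty_face E : E \in penalty_faces M GammaD ->
  E \in interior_faces M \/ E \in boundary_faces M.
Proof.
rewrite inE => /orP[->|]; first by left.
by rewrite inE => /andP[-> _]; right.
Qed.

Lemma penalty_face_face E : E \in penalty_faces M GammaD -> E \in faces M.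
Proof. by case/penalty_face => [/interior_face[]|/boundary_face[]]. Qed.

(** A Neumann facet carries no penalty term, but there the mean of [z] vanishes; so in the lower
    bound every facet of an element is accounted for. *)
Lemma facet_cases E : E \in faces M ->
  E \in penalty_faces M GammaD \/
  (E \in boundary_faces M /\ E \in faces_on M GammaN).
Proof.
move=> EF; have : (0 < #|neighbors E|)%N.
  by move: EF; rewrite inE card_gt0 => /andP[].
rewrite leq_eqVlt => /orP[nb1|nb2]; last by left; rewrite inE inE EF nb2.
have EB : E \in boundary_faces M by rewrite inE EF eq_sym.
have := mesh_bdry HM EB; rewrite /penalty_faces finset.in_setU.
by case: (E \in faces_on M GammaD); [left; rewrite orbT|right].
Qed.

Lemma card_neighbors E : E \in penalty_faces M GammaD -> (#|neighbors E| <= 2)%N.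
Proof.
case/penalty_face => [/interior_face[_ _ _ _ ->]|/boundary_face[_ _ _ ->]].
  by rewrite cards2; case: eqP.
by rewrite cards1.
Qed.

Lemma sum_neighbors (V : nmodType) (F : {set 'I_(nvert M)} -> V) E :
  E \in penalty_faces M GammaD -> \sum_(T in neighbors E) F T =
  F (Tplus E) + (if E \in interior_faces M then F (Tminus E) else 0).
Proof.
case/penalty_face => [/[dup] EI /interior_face[_ _ _ pm ->]|].
  by rewrite EI big_setU1 ?inE //= big_set1.
by case/boundary_face => [_ /negPf -> _ ->]; rewrite big_set1 addr0.
Qed.
End MeshFaces.

Section AffineFields.
Context {R : realType} {d : nat}.
Implicit Types w : 'rV[R]_d -> 'rV[R]_d.

Lemma affine_fieldD w1 w2 : affine_field w1 -> affine_field w2 ->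
  affine_field (fun x => w1 x + w2 x).
Proof.
move=> [G1 [b1 h1]] [G2 [b2 h2]]; exists (G1 + G2), (b1 + b2) => x.
by rewrite h1 h2 mulmxDr addrACA.
Qed.

Lemma affine_fieldZ a w : affine_field w -> affine_field (fun x => a *: w x).
Proof.
move=> [G [b h]]; exists (a *: G), (a *: b) => x.
by rewrite h scalerDr scalemxAr.
Qed.

Lemma affine_fieldB w1 w2 : affine_field w1 -> affine_field w2 ->
  affine_field (fun x => w1 x - w2 x).
Proof.
move=> h1 h2; have := affine_fieldD h1 (affine_fieldZ (-1) h2).
by congr affine_field; apply/funext => x; rewrite scaleN1r.
Qed.
End AffineFields.

(** * Vertex values and the lower bound *)

Section VertexSums.
Context {R : realType} {n : nat} (M : mesh R n.+1).
Context (Omega GammaD GammaN : set 'rV[R]_n.+1).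
Context (HM : mesh_of M Omega GammaD GammaN) (n0 : (0 < n)%N).
Implicit Types (E T : {set 'I_(nvert M)}).

Definition vol E : R := svol (@pt _ _ M) E.

(** For a face [E] and affine [z T] this is [n.+1] times the mean trace over [E]; [jsum] plays the
    same part for the jump. *)
Definition vsum (z : field M) T E : 'rV[R]_n.+1 := \sum_(i in E) z T (pt i).

Definition vsq (z : field M) T : R := \sum_(i in T) dot (z T (pt i)) (z T (pt i)).

Definition jsum (z : field M) E : 'rV[R]_n.+1 := \sum_(i in E) jump z E (pt i).

Lemma cell_intE E f : cell_int E f = sint (@pt _ _ M) E f.
Proof. by []. Qed.

Lemma vol_elem_gt0 T : T \in elems M -> 0 < vol T.
Proof. by move=> TM; exact: svol_gt0 (mesh_card HM TM) (mesh_free HM TM). Qed.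

Lemma hcell_elem_gt0 T : T \in elems M -> 0 < hcell T.
Proof. by move=> TM; exact: diam_gt0 (mesh_card HM TM) (mesh_free HM TM). Qed.

Lemma vol_face_gt0 E : E \in faces M -> 0 < vol E.
Proof.
move=> EF; have := EF; rewrite inE => /andP[_ /finset.set0Pn[T Tn]].
have TM := nb_elems Tn; have [i iT ->] := apex HM EF Tn.
have [u uP] := gradients (mesh_card HM TM) (mesh_free HM TM).
have [_ vE u0 _ _] := uP i iT.
by rewrite /vol vE mulr_gt0 // vol_elem_gt0.
Qed.

Lemma hcell_face_gt0 E : E \in faces M -> 0 < hcell E.
Proof.
move=> EF; have := EF; rewrite inE => /andP[_ /finset.set0Pn[T Tn]].
have TM := nb_elems Tn; have [i iT ->] := apex HM EF Tn.
have [u uP] := gradients (mesh_card HM TM) (mesh_free HM TM).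
have [j jT /(_ (u j))] := facet_diam_grad (@pt _ _ M) (mesh_card HM TM) n0 iT.
have [jP _ v0 _ _] := uP j jT => /(_ jP) h1.
by rewrite -(pmulr_rgt0 _ v0); apply: lt_le_trans h1.
Qed.

Lemma hmesh_ge T : T \in elems M -> hcell T <= hmesh M.
Proof. by move=> TM; rewrite /hmesh; exact: le_bigmax_cond. Qed.

Lemma proj0E E w : E \in faces M -> affine_field w ->
  proj0 E w = n.+1%:R^-1 *: \sum_(i in E) w (pt i).
Proof.
move=> EF wa; have cE := face_card EF.
have E0 : (0 < #|E|)%N by rewrite cE.
apply/rowP => j; rewrite [LHS]mxE [RHS]mxE !cell_intE sint_cst // sint_coord //.
rewrite -/(vol E) cE /= factS natrM.
have v0 : vol E != 0 by rewrite gt_eqF ?vol_face_gt0.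
have k0 : n`!%:R != 0 :> R by rewrite pnatr_eq0 -lt0n fact_gt0.
have k1 : n.+1%:R != 0 :> R by rewrite pnatr_eq0.
by field; rewrite nat1r k1 k0 v0.
Qed.

Lemma sum_elems_faces (F : {set 'I_(nvert M)} -> {set 'I_(nvert M)} -> R) :
  \sum_(T in elems M) \sum_(E in penalty_faces M GammaD | T \in neighbors E) F T E
  = \sum_(E in penalty_faces M GammaD) \sum_(T in neighbors E) F T E.
Proof.
rewrite (exchange_big_dep (mem (penalty_faces M GammaD))) /=; last first.
  by move=> T E _ /andP[].
apply: eq_bigr => E EP; apply: eq_bigl => T; rewrite EP /= inE.
by case: (T \in elems M).
Qed.

Section Field.
Context (z : field M) (zV : VDG z).

Lemma VDG_affine T : T \in elems M -> affine_field (z T).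
Proof. exact: zV. Qed.

Lemma jump_affine E : E \in penalty_faces M GammaD -> affine_field (jump z E).
Proof.
move=> EP; case: (penalty_face EP) => [EI|EB].
  have [_ pn mn _ _] := interior_face HM EI.
  have := affine_fieldB (VDG_affine (nb_elems pn)) (VDG_affine (nb_elems mn)).
  by congr affine_field; apply/funext => x; rewrite /jump EI.
have [_ NI pn _] := boundary_face HM EB.
have := VDG_affine (nb_elems pn).
by congr affine_field; apply/funext => x; rewrite /jump (negPf NI).
Qed.

Lemma jsumE E : jsum z E = if E \in interior_faces M
  then vsum z (Tplus E) E - vsum z (Tminus E) E else vsum z (Tplus E) E.
Proof.
rewrite /jsum /jump /vsum; case: ifP => // _.
by rewrite sumrB.
Qed.

Lemma proj0_jump E : E \in penalty_faces M GammaD ->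
  proj0 E (jump z E) = n.+1%:R^-1 *: jsum z E.
Proof. by move=> EP; rewrite proj0E ?(penalty_face_face HM EP) //; exact: jump_affine. Qed.

Lemma vsum_le E T : T \in neighbors E ->  E \in faces M ->
  dot (vsum z T E) (vsum z T E) <= n.+1%:R * vsq z T.
Proof.
move=> Tn EF; apply: le_trans (dot_sumsq _ _) _.
rewrite (face_card EF) ler_pM2l ?ltr0n // /vsq.
move: Tn; rewrite inE => /andP[_ ET].
rewrite [leRHS](big_setID E) /= (finset.setIidPr ET) lerDl sumr_ge0 // => i _.
exact: dot_ge0.
Qed.

Lemma vsq_ge0 T : 0 <= vsq z T.
Proof. by apply: sumr_ge0 => i _; exact: dot_ge0. Qed.

(** The exact moment is a multiple of [vsq z T + |s|^2], with [s] the sum of the vertex values, and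
    [|s|^2] lies between 0 and [n.+2 * vsq z T]. The upper bound simply drops the factorial
    denominator. *)
Lemma cell_int_sqnorm T : T \in elems M ->
  vol T * vsq z T <= n.+3`!%:R * cell_int T (fun x => dot (z T x) (z T x))
  /\ cell_int T (fun x => dot (z T x) (z T x)) <= n.+3%:R * (vol T * vsq z T).
Proof.
move=> TM; have cT := mesh_card HM TM; have vT := vol_elem_gt0 TM.
have f0 : 0 < n.+3`!%:R :> R by rewrite ltr0n fact_gt0.
rewrite cell_intE sint_sqnorm ?cT //; last exact: VDG_affine.
rewrite -/(vol T) -/(vsq z T); set s := \sum_(i in T) _.
have s0 := dot_ge0 s.
have := dot_sumsq T (fun i => z T (pt i)); rewrite -/s -/(vsq z T) cT => sle.
have q0 := vsq_ge0 T.
split.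
  rewrite [leRHS]mulrA [_ * (vol T / _)]mulrC divfK ?gt_eqF //.
  by rewrite ler_pM2l // lerDl.
apply: (@le_trans _ _ (vol T * (vsq z T + dot s s))).
  apply: ler_wpM2r; first exact: addr_ge0.
  by rewrite ler_pdivrMr // ler_peMr ?(ltW vT) // ler1n fact_gt0.
rewrite [leRHS]mulrCA ler_pM2l // -[n.+3%:R]natr1 mulrDl mul1r addrC.
by rewrite lerD2r.
Qed.

Section Zfield.
Context (zZ : Zspace GammaN z).

Lemma vsum_interior E : E \in interior_faces M ->
  vsum z (Tminus E) E = - vsum z (Tplus E) E.
Proof.
move=> EI; have [EF pn mn _ _] := interior_face HM EI.
have avgE : avg z E = fun x => 2^-1 *: (z (Tplus E) x + z (Tminus E) x).
  by apply/funext => x; rewrite /avg EI.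
have [_ /(_ E)] := zZ; rewrite inE EI => /(_ isT).
rewrite proj0E // avgE; last first.
  by apply/affine_fieldZ/affine_fieldD; apply: VDG_affine;
    [exact: nb_elems pn|exact: nb_elems mn].
move/eqP; rewrite -scaler_sumr scalerA scaler_eq0 mulf_eq0 !invr_eq0 !pnatr_eq0 /=.
by rewrite big_split /= addrC addr_eq0 => /eqP.
Qed.

Lemma vsum_neumann E : E \in boundary_faces M -> E \in faces_on M GammaN ->
  vsum z (Tplus E) E = 0.
Proof.
move=> EB EN; have [EF NI pn _] := boundary_face HM EB.
have avgE : avg z E = z (Tplus E).
  by apply/funext => x; rewrite /avg (negPf NI).
have [_ /(_ E)] := zZ; rewrite finset.in_setU EN orbT => /(_ isT).
rewrite avgE proj0E //; last by apply: VDG_affine; exact: nb_elems pn.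
by move/eqP; rewrite scaler_eq0 invr_eq0 pnatr_eq0 => /eqP.
Qed.

Lemma vsum_jsum E T : E \in penalty_faces M GammaD -> T \in neighbors E ->
  dot (vsum z T E) (vsum z T E) <= dot (jsum z E) (jsum z E).
Proof.
move=> EP; case: (penalty_face EP) => [EI|EB].
  have [_ _ _ _ ->] := interior_face HM EI.
  have jE : jsum z E = 2 *: vsum z (Tplus E) E.
    by rewrite jsumE EI (vsum_interior EI) opprK scaler_nat mulr2n.
  have := dot_ge0 (vsum z (Tplus E) E).
  rewrite finset.in_set2 jE => s0 /orP[]/eqP ->.
    by rewrite dotZl dotZr; lra.
  by rewrite (vsum_interior EI) dotNl dotNr opprK dotZl dotZr; lra.
have [_ NI _ ->] := boundary_face HM EB.
by rewrite finset.in_set1 => /eqP ->; rewrite jsumE (negPf NI).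
Qed.

(** On penalty faces, [h_E^-1 ||P_E^0 [[z]]||_E^2] up to the factor [proj_cst]. *)
Definition pen_term E : R := (hcell E)^-1 * vol E * dot (jsum z E) (jsum z E).

Lemma pen_term_ge0 E : E \in faces M -> 0 <= pen_term E.
Proof.
move=> EF; rewrite !mulr_ge0 ?dot_ge0 // ?invr_ge0 ltW //.
  exact: hcell_face_gt0.
exact: vol_face_gt0.
Qed.

(** The value at a vertex is the total [Z] minus the sum over the opposite facet. Each vertex lies
    on [n.+1] facets, so the facet sums add up to [n.+1] times [Z] and control [Z] as well. *)
Lemma vsq_facets T : T \in elems M ->
  vsq z T <= (2 * n.+2%:R ^+ 2 + 2) *
    \sum_(i in T) dot (vsum z T (T :\ i)%SET) (vsum z T (T :\ i)%SET).
Proof.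
move=> TM; have cT := mesh_card HM TM.
set S := \sum_(i in T) dot _ _.
pose Z := \sum_(i in T) z T (pt i).
have ZE i : i \in T -> z T (pt i) = Z - vsum z T (T :\ i)%SET.
  by move=> iT; rewrite /Z (big_setD1 i) //= /vsum addrK.
have S0 : 0 <= S by apply: sumr_ge0 => i _; exact: dot_ge0.
have ZS : dot Z Z <= n.+2%:R * S.
  have sumS : \sum_(i in T) vsum z T (T :\ i)%SET = n.+1%:R *: Z.
    rewrite (eq_bigr (fun i => Z - z T (pt i))); last by move=> i /ZE ->; rewrite subKr.
    rewrite sumrB sumr_const cT -/Z -scaler_nat -[n.+2%:R]natr1 scalerDl scale1r.
    by rewrite addrK.
  have := dot_sumsq T (fun i => vsum z T (T :\ i)%SET).
  rewrite sumS cT -/S dotZl dotZr; apply: le_trans.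
  by rewrite mulrA ler_peMl ?dot_ge0 // -expr2 exprn_ege1 // ler1n.
have : vsq z T <= \sum_(i in T) (2 * dot Z Z +
    2 * dot (vsum z T (T :\ i)%SET) (vsum z T (T :\ i)%SET)).
  apply: ler_sum => i /ZE ->; set s := vsum _ _ _.
  have := dot_ge0 (Z + s); rewrite !(dotDl, dotDr, dotNl, dotNr) (dotC s Z); lra.
move=> h; apply: le_trans h _.
rewrite big_split /= sumr_const cT -mulr_sumr -/S -[_ *+ n.+2 in leLHS]mulr_natl.
have := ler_wpM2l (ler0n R n.+2) ZS; lra.
Qed.

(** The factors come from [cell_int_sqnorm], from [vsq_facets], from the [n.+2] facets of an element
    and from the at most two elements at a face. *)
Definition lower_cst : R := n.+3%:R * (2 * n.+2%:R ^+ 2 + 2) * n.+2%:R * 2.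

Lemma hmesh_L2_lower :
  (hmesh M) ^- 2 * (L2norm z) ^+ 2 <=
  lower_cst * \sum_(E in penalty_faces M GammaD) pen_term E.
Proof.
pose pen T := \sum_(E in penalty_faces M GammaD | T \in neighbors E) pen_term E.
have pen0 T : 0 <= pen T.
  by apply: sumr_ge0 => E /andP[/(penalty_face_face HM)/pen_term_ge0].
have facetT T i : T \in elems M -> i \in T -> vol T / hcell T ^+ 2 *
    dot (vsum z T (T :\ i)%SET) (vsum z T (T :\ i)%SET) <= pen T.
  move=> TM iT; have [EF Tn] := facet_face HM TM iT.
  case: (facet_cases HM EF) => [EP|[EB EN]]; last first.
    have [_ _ _ nbE] := boundary_face HM EB.
    move: Tn; rewrite nbE finset.in_set1 => /eqP TE.
    by have := vsum_neumann EB EN; rewrite -TE => ->; rewrite dot0r mulr0.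
  rewrite /pen (bigD1 (T :\ i)%SET) ?EP //=.
  apply: ler_wpDr; first by apply: sumr_ge0 => E /andP[/andP[/(penalty_face_face HM)/pen_term_ge0]].
  have vl := facet_vol_lower (mesh_card HM TM) (mesh_free HM TM) iT.
  have hT := hcell_elem_gt0 TM; have hE := hcell_face_gt0 EF.
  apply: ler_pM => //; [|exact: dot_ge0| |exact: vsum_jsum].
    by rewrite divr_ge0 ?sqr_ge0 // ltW // vol_elem_gt0.
  by rewrite [leRHS]mulrC ler_pdivlMr // mulrAC ler_pdivrMr ?exprn_gt0.
have locT T : T \in elems M -> (hmesh M) ^- 2 *
    cell_int T (fun x => dot (z T x) (z T x)) <= lower_cst / 2 * pen T.
  move=> TM; have [_ le1] := cell_int_sqnorm TM.
  have hT := hcell_elem_gt0 TM; have hM := hmesh_ge TM.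
  have h0 : 0 < hmesh M by apply: lt_le_trans hM.
  have vT := vol_elem_gt0 TM.
  have hle : (hmesh M) ^- 2 <= (hcell T) ^- 2.
    by rewrite lef_pV2 ?posrE ?exprn_gt0 // ler_sqr ?nnegrE // ltW.
  have S0 : 0 <= vol T * vsq z T by rewrite mulr_ge0 ?vsq_ge0 // ltW.
  apply: (@le_trans _ _ ((hcell T) ^- 2 * (n.+3%:R * (vol T * vsq z T)))).
    apply: (@le_trans _ _ ((hmesh M) ^- 2 * (n.+3%:R * (vol T * vsq z T)))).
      by rewrite ler_pM2l // invr_gt0 exprn_gt0.
    by rewrite ler_wpM2r // mulr_ge0.
  have le2 : vol T / hcell T ^+ 2 * vsq z T <=
      (2 * n.+2%:R ^+ 2 + 2) * (n.+2%:R * pen T).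
    apply: le_trans (_ : vol T / hcell T ^+ 2 * ((2 * n.+2%:R ^+ 2 + 2) *
      \sum_(i in T) dot (vsum z T (T :\ i)%SET) (vsum z T (T :\ i)%SET)) <= _).
      by rewrite ler_pM2l ?vsq_facets // divr_gt0 ?exprn_gt0.
    rewrite mulrCA; apply: ler_wpM2l; first by rewrite addr_ge0 // mulr_ge0 // sqr_ge0.
    rewrite mulr_sumr -(mesh_card HM TM) mulr_natl -sumr_const.
    by apply: ler_sum => i iT; exact: facetT.
  have -> : lower_cst / 2 * pen T =
      n.+3%:R * ((2 * n.+2%:R ^+ 2 + 2) * (n.+2%:R * pen T)).
    by rewrite /lower_cst; field.
  have -> : (hcell T) ^- 2 * (n.+3%:R * (vol T * vsq z T)) =
      n.+3%:R * (vol T / hcell T ^+ 2 * vsq z T).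
    by field; rewrite gt_eqF.
  by rewrite ler_pM2l // ltr0n.
rewrite /L2norm sqr_sqrtr; last first.
  apply: sumr_ge0 => T TM; have [h _] := cell_int_sqnorm TM.
  have : 0 <= n.+3`!%:R * cell_int T (fun x => dot (z T x) (z T x)).
    by apply: le_trans h; rewrite mulr_ge0 ?vsq_ge0 // ltW // vol_elem_gt0.
  by rewrite pmulr_rge0 // ltr0n fact_gt0.
rewrite mulr_sumr; apply: (@le_trans _ _ (\sum_(T in elems M) lower_cst / 2 * pen T)).
  by apply: ler_sum => T; exact: locT.
rewrite -mulr_sumr -mulrA ler_pM2l; last first.
  rewrite !mulr_gt0 ?ltr0n // addr_gt0 // mulr_gt0 // exprn_gt0 // ltr0n.
rewrite ler_pdivrMl // sum_elems_faces mulr_sumr; apply: ler_sum => E EP.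
rewrite sumr_const mulr_natl; apply: ler_wpMn2l; last exact: card_neighbors HM _ EP.
exact/pen_term_ge0/(penalty_face_face HM).
Qed.
End Zfield.
End Field.
End VertexSums.

(** * Upper bounds *)

Section Elasticity.
Context {R : realType} {d : nat}.
Implicit Types (A G : 'M[R]_d) (u v m nu : 'rV[R]_d).

Lemma frobE A : frob A A = \sum_i dot (row i A) (row i A).
Proof. by apply: eq_bigr => i _; apply: eq_bigr => j _; rewrite mxE. Qed.

Lemma frob_ge0 A : 0 <= frob A A.
Proof. by rewrite frobE; apply: sumr_ge0 => i _; exact: dot_ge0. Qed.

Lemma dot_young (e : R) u v : 0 < e ->
  2 * dot u v <= e * dot u u + e^-1 * dot v v.
Proof.
move=> e0; have := dot_ge0 (e *: u - v).
rewrite !(dotBl, dotBr, dotZl, dotZr) (dotC v u) => h.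
rewrite -(ler_pM2l e0) mulrDr [e * (e^-1 * _)]mulrA divff ?gt_eqF // mul1r; lra.
Qed.

(** Taking symmetric parts is an orthogonal projection for [frob]. *)
Lemma frob_sym_le G : frob (2^-1 *: (G + G^T)) (2^-1 *: (G + G^T)) <= frob G G.
Proof.
have -> : frob G G = \sum_i \sum_j 2^-1 * (G i j ^+ 2 + G j i ^+ 2).
  rewrite (eq_bigr (fun i => 2^-1 * (\sum_j G i j ^+ 2) + 2^-1 * \sum_j G j i ^+ 2)).
    rewrite big_split /= -!mulr_sumr [X in _ + _ * X]exchange_big /=.
    have -> : \sum_i \sum_j G i j ^+ 2 = frob G G by [].
    by field.
  by move=> i _; rewrite -!mulr_sumr big_split mulrDr.
apply: ler_sum => i _; apply: ler_sum => j _; rewrite !mxE.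
by have := sqr_ge0 (G i j - G j i); lra.
Qed.

(** Cauchy-Schwarz on the diagonal against the all-ones vector; here the [d] of [beta0]
    originates. *)
Lemma mxtrace_sqr_le A : \tr A ^+ 2 <= d%:R * frob A A.
Proof.
have := dot_CS (\row_i A i i) (const_mx 1).
have -> : dot (\row_i A i i) (const_mx 1) = \tr A.
  by apply: eq_bigr => i _; rewrite !mxE mulr1.
have -> : dot (const_mx 1 : 'rV[R]_d) (const_mx 1) = d%:R.
  transitivity (\sum_(i < d) (1 : R)); last by rewrite sumr_const card_ord.
  by apply: eq_bigr => i _; rewrite !mxE mulr1.
move=> h; apply: le_trans h _; rewrite mulrC ler_wpM2l // frobE.
apply: ler_sum => i _; rewrite !mxE /dot (bigD1 i) //= !mxE lerDl.
by apply: sumr_ge0 => j _; rewrite mxE -expr2 sqr_ge0.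
Qed.

Lemma elast_frobE (lambda mu : R) A :
  frob (elast lambda mu A) A = 2 * mu * frob A A + lambda * \tr A ^+ 2.
Proof.
rewrite /frob mulr_sumr expr2 mulrA [X in _ + X]mulr_sumr -big_split /=.
apply: eq_bigr => i _; rewrite mulr_sumr [X in _ + X](_ : _ =
    \sum_j lambda * \tr A * (i == j)%:R * A i j).
  rewrite -big_split /=; apply: eq_bigr => j _; rewrite !mxE.
  by case: (i == j); rewrite /= ?mulr1n ?mulr0n; ring.
rewrite (bigD1 i) //= eqxx mulr1 big1 ?addr0 // => j /negPf ij.
by rewrite eq_sym ij mulr0 mul0r.
Qed.

Lemma elast_frob_ge0 (lambda mu : R) A : 0 <= lambda -> 0 < mu ->
  0 <= frob (elast lambda mu A) A.
Proof.
move=> l0 m0; rewrite elast_frobE addr_ge0 // mulr_ge0 ?sqr_ge0 ?frob_ge0 //.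
by rewrite mulr_ge0 // ltW.
Qed.

Lemma elast_frob_le (lambda mu : R) A : 0 <= lambda ->
  frob (elast lambda mu A) A <= beta0 d lambda mu * frob A A.
Proof.
move=> l0; rewrite elast_frobE /beta0.
have := ler_wpM2l l0 (mxtrace_sqr_le A); lra.
Qed.

(** Young's inequality is applied separately to [A nu], weighted by [2 mu], and to [tr A nu],
    weighted by [lambda], so that the parameters combine exactly into [beta0]. *)
Lemma traction_le (lambda mu e : R) A nu m : 0 <= lambda -> 0 < mu -> 0 < e ->
  (0 < d)%N -> enorm nu = 1 ->
  2 * dot (elast lambda mu A *m nu^T)^T m <=
  beta0 d lambda mu * (e * frob A A + e^-1 * dot m m).
Proof.
move=> l0 m0 e0 d0 nu1.
have nn : dot nu nu = 1 by rewrite -sqr_enorm nu1 expr1n.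
pose a := (A *m nu^T)^T.
have -> : (elast lambda mu A *m nu^T)^T = (2 * mu) *: a + (lambda * \tr A) *: nu.
  rewrite /elast mulmxDl -!scalemxAl mul1mx.
  by apply/rowP => j; rewrite !mxE.
rewrite dotDl !dotZl.
have aa : dot a a <= frob A A.
  rewrite frobE /dot; apply: ler_sum => i _.
  have -> : a 0 i = dot (row i A) nu.
    by rewrite !mxE; apply: eq_bigr => j _; rewrite !mxE.
  by rewrite -expr2; have := dot_CS (row i A) nu; rewrite nn mulr1.
have y1 := dot_young a m e0.
have y2 := dot_young (\tr A *: nu) m e0.
move: y2; rewrite !dotZl dotZr nn mulr1 => y2.
have tr := mxtrace_sqr_le A.
have d1 : 1 <= d%:R :> R by rewrite ler1n.
have mm : 0 <= e^-1 * dot m m by rewrite mulr_ge0 ?dot_ge0 // invr_ge0 ltW.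
have b1 : 2 * dot a m <= e * frob A A + e^-1 * dot m m.
  by apply: le_trans y1 _; rewrite lerD2r ler_pM2l.
have b2 : 2 * (\tr A * dot nu m) <= d%:R * (e * frob A A + e^-1 * dot m m).
  apply: le_trans y2 _; rewrite mulrDr; apply: lerD; last by rewrite ler_peMl.
  by rewrite [leRHS]mulrCA ler_pM2l // -expr2.
have c1 := ler_wpM2l (ltW m0) b1; have c2 := ler_wpM2l l0 b2.
rewrite /beta0; lra.
Qed.
End Elasticity.

(** * Bounds for the terms of the bilinear forms *)

Section Forms.
Context {R : realType} {n : nat} (M : mesh R n.+1).
Context (Omega GammaD GammaN : set 'rV[R]_n.+1).
Context (HM : mesh_of M Omega GammaD GammaN) (n0 : (0 < n)%N).
Context (z : field M) (zV : VDG z) (zZ : Zspace GammaN z).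
Implicit Types (E T : {set 'I_(nvert M)}).

Let pens := penalty_faces M GammaD.

(** Of the two factors [1 / n.+1] that turn vertex sums into means, one merges with the [1 / n!] in
    the measure of the face. *)
Definition proj_cst : R := (n.+1%:R * n.+1`!%:R)^-1.

Lemma proj_cst_gt0 : 0 < proj_cst.
Proof. by rewrite invr_gt0 mulr_gt0 ?ltr0n ?fact_gt0. Qed.

Lemma pen_proj E : E \in pens -> (hcell E)^-1 *
  cell_int E (fun x => dot (jump z E x) (proj0 E (jump z E))) =
  proj_cst * pen_term z E.
Proof.
move=> EP; have EF := penalty_face_face HM EP; have cE := face_card EF.
have -> : (fun x => dot (jump z E x) (proj0 E (jump z E))) =
    fun x => dot (proj0 E (jump z E)) (jump z E x) by apply/funext => x; exact: dotC.
rewrite cell_intE sint_dot ?cE //; last exact: (jump_affine HM).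
rewrite -/(vol E) -/(jsum z E) (proj0_jump HM zV EP) dotZl /proj_cst /pen_term.
by rewrite invfM; ring.
Qed.

(** [A0] pairs the jump with its projection and [stable] the projection with itself; the projection
    being orthogonal, the values agree. *)
Lemma pen_proj_cst E : E \in pens -> (hcell E)^-1 *
  cell_int E (fun=> dot (proj0 E (jump z E)) (proj0 E (jump z E))) =
  proj_cst * pen_term z E.
Proof.
move=> EP; have EF := penalty_face_face HM EP; have cE := face_card EF.
rewrite cell_intE sint_cst ?cE // -/(vol E) (proj0_jump HM zV EP) dotZl dotZr.
by rewrite /proj_cst /pen_term factS natrM !invfM; ring.
Qed.

Definition jump_term E : R :=
  (hcell E)^-1 * cell_int E (fun x => dot (jump z E x) (jump z E x)).

Lemma jump_termE E : E \in pens -> jump_term E = (hcell E)^-1 *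
  (vol E / n.+2`!%:R * (\sum_(i in E) dot (jump z E (pt i)) (jump z E (pt i)) +
     dot (jsum z E) (jsum z E))).
Proof.
move=> EP; have EF := penalty_face_face HM EP; have cE := face_card EF.
by rewrite /jump_term cell_intE sint_sqnorm ?cE //; exact: (jump_affine HM).
Qed.

(** [P_E^0] does not increase the norm. In vertex values this is Cauchy-Schwarz,
    [|jsum z E|^2 <= n.+1 * S], inserted into the exact moment. *)
Lemma pen_le_jump E : E \in pens -> proj_cst * pen_term z E <= jump_term E.
Proof.
move=> EP; have EF := penalty_face_face HM EP; have cE := face_card EF.
rewrite jump_termE // /pen_term /proj_cst.
have := dot_sumsq E (fun i => jump z E (pt i)); rewrite -/(jsum z E) cE.
set S := \sum_(i in E) _; set JJ := dot _ _ => le1.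
have k1 : 0 < n.+1%:R :> R by rewrite ltr0n.
have k2 : 0 < n.+2%:R :> R by rewrite ltr0n.
have kf : 0 < n.+1`!%:R :> R by rewrite ltr0n fact_gt0.
have -> : (n.+1%:R * n.+1`!%:R)^-1 * ((hcell E)^-1 * vol E * JJ) =
   (hcell E)^-1 * (vol E / n.+2`!%:R * (n.+2%:R * (n.+1%:R^-1 * JJ))).
  have alg (a k f h v J : R) : a != 0 -> k != 0 -> f != 0 -> h != 0 ->
      (a * f)^-1 * (h^-1 * v * J) = h^-1 * (v / (k * f) * (k * (a^-1 * J))).
    by move=> a0 k0 f0 h0; field; rewrite a0 k0 f0 h0.
  rewrite [n.+2`!]factS natrM; apply: alg; rewrite gt_eqF //.
  exact: (hcell_face_gt0 HM).
rewrite ler_pM2l ?invr_gt0 ?(hcell_face_gt0 HM n0 EF) //.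
rewrite ler_pM2l ?divr_gt0 ?(vol_face_gt0 HM EF) ?ltr0n ?fact_gt0 //.
rewrite -[n.+2%:R]natr1 mulrDl mul1r mulrA divff ?gt_eqF // mul1r addrC lerD2r.
by rewrite ler_pdivrMl.
Qed.

Lemma sum_sub_le E T : T \in neighbors E ->
  \sum_(i in E) dot (z T (pt i)) (z T (pt i)) <= vsq z T.
Proof.
rewrite inE => /andP[_ ET]; rewrite /vsq [leRHS](big_setID E) /=.
by rewrite (finset.setIidPr ET) lerDl sumr_ge0 // => i _; exact: dot_ge0.
Qed.

Section Shape.
Context (sigma : R) (HS : shape_regular M sigma).

(** Equivalent to [h_T^-2 ||z||_T^2]; all upper bounds are expressed through it. *)
Definition loc T : R := vol T * vsq z T / hcell T ^+ 2.

Lemma loc_ge0 T : T \in elems M -> 0 <= loc T.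
Proof.
move=> TM; rewrite divr_ge0 ?sqr_ge0 // mulr_ge0 ?vsq_ge0 // ltW //.
exact: (vol_elem_gt0 HM).
Qed.

Lemma face_vsq_le E T : E \in faces M -> T \in neighbors E ->
  (hcell E)^-1 * vol E * vsq z T <= sigma ^+ 2 * loc T.
Proof.
move=> EF Tn; have TM := nb_elems Tn; have [i iT Ei] := apex HM EF Tn.
have [hE] := facet_vol_upper (mesh_card HM TM) (mesh_free HM TM) n0 (HS TM) iT.
rewrite -Ei -/(hcell E) -/(vol E) => le1.
have hT := hcell_elem_gt0 HM TM.
have -> : sigma ^+ 2 * loc T = (sigma ^+ 2 * vol T / hcell T ^+ 2) * vsq z T.
  by rewrite /loc; ring.
apply: ler_wpM2r; first exact: vsq_ge0.
rewrite mulrC ler_pdivrMr; last by rewrite Ei.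
by rewrite mulrAC ler_pdivlMr ?exprn_gt0 // mulrAC.
Qed.

Lemma jump_term_le E : E \in pens ->
  jump_term E <= 2 * sigma ^+ 2 * \sum_(T in neighbors E) loc T.
Proof.
move=> EP; have EF := penalty_face_face HM EP; have cE := face_card EF.
have k2 : 0 < n.+2%:R :> R by rewrite ltr0n.
have kf : 0 < n.+2`!%:R :> R by rewrite ltr0n fact_gt0.
have hE := hcell_face_gt0 HM n0 EF; have vE := vol_face_gt0 HM EF.
rewrite jump_termE //.
have := dot_sumsq E (fun i => jump z E (pt i)); rewrite -/(jsum z E) cE.
set S := \sum_(i in E) _; set JJ := dot _ _ => le1.
have S0 : 0 <= S by apply: sumr_ge0 => i _; exact: dot_ge0.
have Sle : S <= 2 * \sum_(T in neighbors E) vsq z T.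
  rewrite (sum_neighbors HM _ EP) /S; case: (penalty_face EP) => [EI|EB].
    have [_ pn mn _ _] := interior_face HM EI; rewrite EI.
    have sp := sum_sub_le pn; have sm := sum_sub_le mn.
    apply: (@le_trans _ _ (\sum_(i in E) (2 * dot (z (Tplus E) (pt i)) (z (Tplus E) (pt i))
       + 2 * dot (z (Tminus E) (pt i)) (z (Tminus E) (pt i))))).
      apply: ler_sum => i _; rewrite /jump EI; set a := z _ _; set b := z _ _.
      by have := dot_ge0 (a + b); rewrite !(dotDl, dotDr, dotNl, dotNr) (dotC b a); lra.
    by rewrite big_split /= -!mulr_sumr -mulrDr ler_pM2l // lerD.
  have [_ NI pn _] := boundary_face HM EB; rewrite (negPf NI) addr0.
  have sp := sum_sub_le pn; have q0 := vsq_ge0 z (Tplus E).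
  rewrite (eq_bigr (fun i => dot (z (Tplus E) (pt i)) (z (Tplus E) (pt i)))).
    by apply: le_trans sp _; lra.
  by move=> i _; rewrite /jump (negPf NI).
apply: (@le_trans _ _ ((hcell E)^-1 * (vol E * S))).
  rewrite ler_pM2l ?invr_gt0 // -mulrA ler_pM2l // mulrC ler_pdivrMr //.
  apply: (@le_trans _ _ (S * n.+2%:R)).
    by rewrite -[n.+2%:R]natr1 mulrDr mulr1 addrC lerD2r mulrC.
  by apply: ler_wpM2l => //; rewrite ler_nat fact_geq.
apply: (@le_trans _ _ ((hcell E)^-1 * (vol E * (2 * \sum_(T in neighbors E) vsq z T)))).
  by rewrite !ler_pM2l ?invr_gt0.
have -> (q : R) : (hcell E)^-1 * (vol E * (2 * q)) = 2 * ((hcell E)^-1 * vol E * q).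
  by ring.
rewrite -[leRHS]mulrA ler_pM2l ?ltr0n // !mulr_sumr.
apply: ler_sum => T Tn.
exact: face_vsq_le.
Qed.

Lemma strain_cst T : T \in elems M -> exists2 A : 'M[R]_n.+1,
  (forall x, strain z T x = A) &
  hcell T ^+ 2 * frob A A <= n.+2%:R * sigma ^+ 2 * vsq z T.
Proof.
move=> TM; have [G [b zE]] := zV TM.
exists (2^-1 *: (G + G^T)) => [x|].
  rewrite /strain; have -> : z T = fun x => x *m G + b by exact/funext.
  by rewrite jacobian_affine.
apply: (@le_trans _ _ (hcell T ^+ 2 * frob G G)).
  by apply: ler_wpM2l; [exact: sqr_ge0|exact: frob_sym_le].
have := inverse_ineq (mesh_card HM TM) (mesh_free HM TM) G b (HS TM).
by rewrite /vsq; congr (_ <= _ * _); apply: eq_bigr => i _; rewrite zE.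
Qed.

Section Lame.
Context (lambda mu : R) (l0 : 0 <= lambda) (m0 : 0 < mu).

Let b0 := beta0 n.+1 lambda mu.

Lemma beta0_gt0 : 0 < b0.
Proof. by rewrite ltr_wpDl ?mulr_gt0 // mulr_ge0. Qed.

Lemma energy_ge0 : 0 <= energy lambda mu z z.
Proof.
apply: sumr_ge0 => T TM; have [A AE _] := strain_cst TM.
have -> : (fun x => frob (elast lambda mu (strain z T x)) (strain z T x)) =
    fun=> frob (elast lambda mu A) A by apply/funext => x; rewrite AE.
rewrite cell_intE sint_cst ?(mesh_card HM TM) // mulr_ge0 ?elast_frob_ge0 //.
by rewrite divr_ge0 ?svol_ge0.
Qed.

Lemma energy_le :
  energy lambda mu z z <= b0 * (n.+2%:R * sigma ^+ 2) * \sum_(T in elems M) loc T.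
Proof.
rewrite mulr_sumr; apply: ler_sum => T TM; have [A AE Ale] := strain_cst TM.
have -> : (fun x => frob (elast lambda mu (strain z T x)) (strain z T x)) =
    fun=> frob (elast lambda mu A) A by apply/funext => x; rewrite AE.
have b1 := beta0_gt0; have vT := vol_elem_gt0 HM TM; have hT := hcell_elem_gt0 HM TM.
rewrite cell_intE sint_cst ?(mesh_card HM TM) //= -/(vol T).
apply: (@le_trans _ _ (vol T * (b0 * frob A A))).
  apply: ler_pM; rewrite ?elast_frob_ge0 ?elast_frob_le //.
    by rewrite divr_ge0 // ltW.
  by rewrite ler_pdivrMr ?ltr0n ?fact_gt0 // ler_peMr ?(ltW vT) // ler1n fact_gt0.
rewrite mulrCA -mulrA ler_pM2l // /loc.
have -> : n.+2%:R * sigma ^+ 2 * (vol T * vsq z T / hcell T ^+ 2) =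
    vol T * (n.+2%:R * sigma ^+ 2 * vsq z T / hcell T ^+ 2) by ring.
by rewrite ler_pM2l // ler_pdivlMr ?exprn_gt0 // mulrC.
Qed.

(** One factor [1 + sigma ^+ 2] bounds [vol E * h_T / vol T], the other collects the strain and the
    trace. *)
Definition trac_cst : R := n.+2%:R * (1 + sigma ^+ 2) ^+ 2.

Lemma face_traction_le E T A m : E \in faces M -> T \in neighbors E ->
  dot m m <= n.+1%:R * vsq z T ->
  hcell T ^+ 2 * frob A A <= n.+2%:R * sigma ^+ 2 * vsq z T ->
  vol E / n.+1`!%:R * (2 * dot (elast lambda mu A *m (nrm E)^T)^T m) <=
  b0 * trac_cst * loc T.
Proof.
move=> EF Tn mle Ale.
have TM := nb_elems Tn; have [i iT Ei] := apex HM EF Tn.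
have hT := hcell_elem_gt0 HM TM; have vT := vol_elem_gt0 HM TM.
have vE := vol_face_gt0 HM EF; have b1 := beta0_gt0; have q0 := vsq_ge0 z T.
have := facet_vol_height (mesh_card HM TM) (mesh_free HM TM) (HS TM) iT.
rewrite -Ei -/(vol E) -/(vol T) -/(hcell T) => vle.
(* The Young weight [e = h_T] puts the terms in [|A|^2] and [|m|^2] both on the scale
   [h_T^-1 * vsq z T]. *)
have tle := traction_le A m l0 m0 hT (ltn0Sn n) (mesh_nrm_unit HM EF).
set K := 1 + sigma ^+ 2 in vle *.
have K1 : 1 <= K by rewrite lerDl sqr_ge0.
have inner : hcell T * frob A A + (hcell T)^-1 * dot m m <=
    (hcell T)^-1 * (n.+2%:R * K * vsq z T).
  rewrite -(ler_pM2l hT) mulrDr !mulrA divff ?gt_eqF // !mul1r -expr2.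
  apply: le_trans (lerD Ale mle) _; rewrite /K -[n.+2%:R]natr1; lra.
pose Y := b0 * ((hcell T)^-1 * (n.+2%:R * K * vsq z T)).
have Y0 : 0 <= Y.
  rewrite !mulr_ge0 ?invr_ge0 ?(ltW b1) ?(ltW hT) //.
  exact: le_trans ler01 K1.
have XY : 2 * dot (elast lambda mu A *m (nrm E)^T)^T m <= Y.
  by apply: le_trans tle _; rewrite ler_pM2l.
have f1 : 1 <= n.+1`!%:R :> R by rewrite ler1n fact_gt0.
have f0 : 0 < n.+1`!%:R :> R by apply: lt_le_trans f1.
apply: (@le_trans _ _ (vol E * Y)).
  apply: (@le_trans _ _ (vol E / n.+1`!%:R * Y)); first by rewrite ler_pM2l ?divr_gt0.
  by apply: ler_wpM2r => //; rewrite ler_pdivrMr // ler_peMr ?(ltW vE).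
have vle' : vol E <= K * vol T / hcell T by rewrite ler_pdivlMr.
apply: le_trans (ler_wpM2r Y0 vle') _; rewrite /Y /trac_cst -/K /loc.
rewrite le_eqVlt; apply/orP; left; apply/eqP.
by field; rewrite gt_eqF.
Qed.

Lemma traction_cst T E : T \in elems M -> exists2 A : 'M[R]_n.+1,
  (forall x, traction lambda mu z E T x = (elast lambda mu A *m (nrm E)^T)^T) &
  hcell T ^+ 2 * frob A A <= n.+2%:R * sigma ^+ 2 * vsq z T.
Proof.
move=> TM; have [A AE Ale] := strain_cst TM; exists A => // x.
by rewrite /traction AE.
Qed.

Definition cross_term E : R := cell_int E (fun x =>
  dot (avg (traction lambda mu z E) E x) (jump z E x)
  + dot (jump z E x) (avg (traction lambda mu z E) E x)).

Lemma cross_termE E c : E \in pens ->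
  (forall x, avg (traction lambda mu z E) E x = c) ->
  cross_term E = vol E / n.+1`!%:R * (2 * dot c (jsum z E)).
Proof.
move=> EP cE; have EF := penalty_face_face HM EP; have kE := face_card EF.
rewrite /cross_term cell_intE.
have -> : (fun x => dot (avg (traction lambda mu z E) E x) (jump z E x)
    + dot (jump z E x) (avg (traction lambda mu z E) E x)) =
    fun x => dot (2 *: c) (jump z E x).
  by apply/funext => x; rewrite !cE dotZl [dot (jump z E x) _]dotC; ring.
by rewrite sint_dot ?kE ?dotZl //; exact: (jump_affine HM).
Qed.

Lemma cross_term_ge E : E \in pens ->
  - cross_term E <= b0 * trac_cst * \sum_(T in neighbors E) loc T.
Proof.
move=> EP; have EF := penalty_face_face HM EP.
rewrite (sum_neighbors HM _ EP) mulrDr; case: (penalty_face EP) => [EI|EB].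
  have [_ pn mn _ _] := interior_face HM EI; rewrite EI.
  have [Ap tp Ap_le] := traction_cst E (nb_elems pn).
  have [Am tm Am_le] := traction_cst E (nb_elems mn).
  set cp := trmx _ in tp; set cm := trmx _ in tm.
  rewrite (@cross_termE _ (2^-1 *: (cp + cm))) //; last first.
    by move=> x; rewrite /avg EI tp tm.
  have jp : jsum z E = 2 *: vsum z (Tplus E) E.
    by rewrite jsumE EI (vsum_interior HM zV zZ EI) opprK scaler_nat mulr2n.
  have sp := vsum_le z pn EF; have sm := vsum_le z mn EF.
  (* [jsum z E] is twice the sum from [T^+] and minus twice the sum from [T^-]; this dictates the
     signs when the averaged traction is split into its two halves. *)
  have fp := @face_traction_le E _ Ap (- vsum z (Tplus E) E) EF pn.
  have fm := @face_traction_le E _ Am (vsum z (Tminus E) E) EF mn.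
  have := lerD (fp _ Ap_le) (fm sm Am_le); rewrite -/cp -/cm.
  rewrite dotNl dotNr opprK => /(_ sp) le1; apply: le_trans le1.
  rewrite jp (vsum_interior HM zV zZ EI) !(dotNr, dotZl, dotZr, dotDl).
  by rewrite le_eqVlt; apply/orP; left; apply/eqP; field.
have [_ NI pn _] := boundary_face HM EB; rewrite (negPf NI) mulr0 addr0.
have [Ap tp Ap_le] := traction_cst E (nb_elems pn).
set cp := trmx _ in tp.
rewrite (@cross_termE _ cp) //; last by move=> x; rewrite /avg (negPf NI) tp.
rewrite jsumE (negPf NI) -mulrN -mulrN -dotNr.
apply: (face_traction_le EF pn) => //.
by rewrite dotNl dotNr opprK; exact: vsum_le.
Qed.
End Lame.

(** All subsets of the [n.+2] vertices of [T] are counted instead of its facets: crude, but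
    independent of the mesh. *)
Lemma sum_loc_faces : \sum_(E in pens) \sum_(T in neighbors E) loc T <=
  2 ^+ n.+2 * \sum_(T in elems M) loc T.
Proof.
rewrite -(sum_elems_faces GammaD (fun T _ => loc T)) mulr_sumr.
apply: ler_sum => T TM; rewrite sumr_const -[leLHS]mulr_natl ler_wpM2r ?loc_ge0 //.
rewrite -natrX ler_nat -(mesh_card HM TM) -card_powerset; apply: subset_leq_card.
apply/fintype.subsetP => E; rewrite unfold_in => /andP[_].
by rewrite !inE => /andP[].
Qed.

Lemma sum_loc_L2 tau : quasi_uniform M tau ->
  \sum_(T in elems M) loc T <=
  tau ^+ 2 * n.+3`!%:R * ((hmesh M) ^- 2 * (L2norm z) ^+ 2).
Proof.
move=> QU; have c0 T : T \in elems M -> 0 <= cell_int T (fun x => dot (z T x) (z T x)).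
  move=> TM; have [h _] := cell_int_sqnorm HM zV TM.
  have : 0 <= n.+3`!%:R * cell_int T (fun x => dot (z T x) (z T x)).
    by apply: le_trans h; rewrite mulr_ge0 ?vsq_ge0 // ltW // (vol_elem_gt0 HM).
  by rewrite pmulr_rge0 // ltr0n fact_gt0.
rewrite /L2norm sqr_sqrtr; last exact: sumr_ge0.
rewrite !mulr_sumr; apply: ler_sum => T TM.
have [h _] := cell_int_sqnorm HM zV TM; have q0 := c0 _ TM.
have hT := hcell_elem_gt0 HM TM; have hM := hmesh_ge TM.
have h0 : 0 < hmesh M by apply: lt_le_trans hM.
have hle : (hcell T) ^- 2 <= tau ^+ 2 * (hmesh M) ^- 2.
  rewrite ler_pdivlMr ?exprn_gt0 // mulrC ler_pdivrMr ?exprn_gt0 //.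
  by rewrite -exprMn ler_sqr ?nnegrE ?(ltW h0) ?QU // (le_trans (ltW h0)) ?QU.
rewrite /loc mulrC; set q := cell_int _ _ in h q0 *.
have -> : tau ^+ 2 * n.+3`!%:R * ((hmesh M) ^- 2 * q) =
    tau ^+ 2 * (hmesh M) ^- 2 * (n.+3`!%:R * q) by ring.
apply: ler_pM => //; first by rewrite invr_ge0 sqr_ge0.
by rewrite mulr_ge0 ?vsq_ge0 // ltW // (vol_elem_gt0 HM).
Qed.
End Shape.
End Forms.

(** * Bounds uniform in the parameters and conclusion *)

Lemma form_bounds (R : realType) (n : nat) (sigma tau : R) : (0 < n)%N ->
  exists2 C : R, 0 < C &
  forall (Omega GammaD GammaN : set 'rV[R]_n.+1) (mu lambda alpha0 : R),
    0 < mu -> 0 <= lambda -> 1 <= alpha0 ->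
  forall M : mesh R n.+1,
    mesh_of M Omega GammaD GammaN -> shape_regular M sigma ->
    stable M GammaD lambda mu alpha0 ->
  forall z : field M, Zspace GammaN z ->
    let X := (hmesh M) ^- 2 * (L2norm z) ^+ 2 in
    let J := \sum_(E in penalty_faces M GammaD) jump_term z E in
    let ab := alpha0 * beta0 n.+1 lambda mu in
    [/\ ab * X <= C * A0 GammaD lambda mu alpha0 z z, X <= C * J &
      quasi_uniform M tau ->
      A0 GammaD lambda mu alpha0 z z <= C * (ab * X) /\ J <= C * X].
Proof.
move=> n0.
pose P := @proj_cst R n; have P0 : 0 < P := proj_cst_gt0.
pose Lc := @lower_cst R n.
have Lc0 : 0 < Lc.
  rewrite !mulr_gt0 ?ltr0n // addr_gt0 // mulr_gt0 // exprn_gt0 // ltr0n.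
pose F : R := 2 ^+ n.+2; have F0 : 0 < F by rewrite exprn_gt0.
(* The summands belong to the energy, the consistency terms and the penalty; [F] is the count from
   [sum_loc_faces]. *)
pose CU := n.+2%:R * sigma ^+ 2 + @trac_cst R n sigma * F + 2 * sigma ^+ 2 * F.
have s0 := sqr_ge0 sigma.
have tr0 : 0 <= @trac_cst R n sigma * F.
  by rewrite mulr_ge0 ?(ltW F0) // mulr_ge0 // sqr_ge0.
have t0 : 0 <= 2 * sigma ^+ 2 * F by rewrite mulr_ge0 ?(ltW F0) // mulr_ge0.
have CU0 : 0 <= CU by rewrite addr_ge0 // addr_ge0 // mulr_ge0.
pose Q := tau ^+ 2 * n.+3`!%:R; have Q0 : 0 <= Q by rewrite mulr_ge0 ?sqr_ge0.
have c10 : 0 < 2 * Lc / P by rewrite divr_gt0 // mulr_gt0.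
have c20 : 0 <= CU * Q by rewrite mulr_ge0.
(* The first summand serves the lower bounds, the second the upper ones. *)
exists (2 * Lc / P + CU * Q); first by rewrite ltr_pwDl.
move=> Omega GammaD GammaN mu lambda alpha0 m0 l0 a0 M HM HS st z zZ X J ab.
have zV : VDG z by case: zZ.
set A := A0 _ _ _ _ _ _.
pose J0 := \sum_(E in penalty_faces M GammaD) pen_term z E.
pose L := \sum_(T in elems M) loc z T.
have L0 : 0 <= L by apply: sumr_ge0 => T; exact: (loc_ge0 HM).
have X0 : 0 <= X by rewrite mulr_ge0 ?sqr_ge0 // invr_ge0 sqr_ge0.
have F1 : X <= Lc * J0 := hmesh_L2_lower HM n0 zV zZ.
have b1 : 0 < beta0 n.+1 lambda mu := beta0_gt0 l0 m0.
have ab0 : 0 < ab by rewrite mulr_gt0 // (lt_le_trans ltr01).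
have J00 : 0 <= J0.
  apply: sumr_ge0 => E EP; apply: (pen_term_ge0 HM n0).
  exact: (penalty_face_face HM EP).
have PJ : P * J0 <= J.
  by rewrite mulr_sumr; apply: ler_sum => E EP; exact: (pen_le_jump HM n0 zV EP).
have J_ge0 : 0 <= J by apply: le_trans PJ; rewrite mulr_ge0 // ltW.
have JL : J <= 2 * sigma ^+ 2 * F * L.
  apply: (@le_trans _ _ (\sum_(E in penalty_faces M GammaD)
      2 * sigma ^+ 2 * \sum_(T in neighbors E) loc z T)).
    by apply: ler_sum => E EP; exact: (jump_term_le HM n0 zV HS EP).
  rewrite -mulr_sumr -[leRHS]mulrA; apply: ler_wpM2l; first by rewrite mulr_ge0.
  exact: (sum_loc_faces HM).
have stA : ab / 2 * (P * J0) <= A.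
  have := st z zV; apply: le_trans.
  have -> : \sum_(E in penalty_faces M GammaD) (hcell E)^-1 *
      cell_int E (fun=> dot (proj0 E (jump z E)) (proj0 E (jump z E))) = P * J0.
    by rewrite mulr_sumr; apply: eq_bigr => E EP; exact: (pen_proj_cst HM zV EP).
  have en := energy_ge0 HM zV HS l0 m0; rewrite /ab; lra.
have A_ge0 : 0 <= A.
  apply: le_trans stA; apply: mulr_ge0; first by rewrite divr_ge0 // ltW.
  by rewrite mulr_ge0 // ltW.
have AE : A = energy lambda mu z z
    - \sum_(E in penalty_faces M GammaD) cross_term z lambda mu E + ab * (P * J0).
  rewrite /A /A0; congr (_ + _ * _).
  by rewrite mulr_sumr; apply: eq_bigr => E EP; exact: (pen_proj HM zV EP).
have AL : A <= ab * (CU * L).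
  have en := energy_le HM zV HS l0 m0.
  have cr : - \sum_(E in penalty_faces M GammaD) cross_term z lambda mu E <=
      beta0 n.+1 lambda mu * (@trac_cst R n sigma * F * L).
    rewrite -sumrN; apply: (@le_trans _ _ (\sum_(E in penalty_faces M GammaD)
        beta0 n.+1 lambda mu * @trac_cst R n sigma * \sum_(T in neighbors E) loc z T)).
      by apply: ler_sum => E EP; exact: (cross_term_ge HM zV zZ HS l0 m0 EP).
    rewrite -mulr_sumr -mulrA ler_pM2l // -[leRHS]mulrA; apply: ler_wpM2l.
      by rewrite mulr_ge0 // sqr_ge0.
    exact: (sum_loc_faces HM).
  (* [alpha0 >= 1] absorbs the bare [beta0] of the energy and consistency terms into [ab]. *)
  have b_ab (q : R) : 0 <= q -> beta0 n.+1 lambda mu * q <= ab * q.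
    by move=> q0; rewrite /ab -mulrA ler_peMl // mulr_ge0 // ltW.
  have e1 := b_ab (n.+2%:R * sigma ^+ 2 * L).
  have e2 := b_ab (@trac_cst R n sigma * F * L).
  have e3 : ab * (P * J0) <= ab * (2 * sigma ^+ 2 * F * L).
    by rewrite ler_pM2l // (le_trans PJ).
  have -> : ab * (CU * L) = ab * (n.+2%:R * sigma ^+ 2 * L)
      + ab * (@trac_cst R n sigma * F * L) + ab * (2 * sigma ^+ 2 * F * L).
    by rewrite /CU; ring.
  rewrite AE; apply: lerD; last exact: e3.
  apply: lerD; [apply: le_trans en _|apply: le_trans cr _].
    by rewrite -/L -mulrA; apply: e1; rewrite mulr_ge0 // mulr_ge0.
  by apply: e2; rewrite mulr_ge0.
have abX : ab * X <= 2 * Lc / P * A.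
  apply: (@le_trans _ _ (ab * (Lc * J0))); first by rewrite ler_pM2l.
  have -> : ab * (Lc * J0) = 2 * Lc / P * (ab / 2 * (P * J0)).
    by field; rewrite gt_eqF.
  by rewrite ler_pM2l.
have XJ : X <= 2 * Lc / P * J.
  apply: le_trans F1 _; apply: (@le_trans _ _ (Lc / P * J)).
    by rewrite -mulrA ler_pM2l // ler_pdivlMl.
  by rewrite ler_wpM2r // ler_pM2r ?invr_gt0 // ler_peMl ?ler1n // ltW.
split.
- by apply: le_trans abX _; rewrite ler_wpM2r // lerDl.
- by apply: le_trans XJ _; rewrite ler_wpM2r // lerDl.
move=> QU; have LX : L <= Q * X := sum_loc_L2 HM zV QU.
split.
  apply: le_trans AL _; rewrite [leRHS]mulrCA ler_pM2l // [leRHS]mulrDl.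
  apply: ler_wpDl; first by rewrite mulr_ge0 // ltW.
  by rewrite -mulrA ler_wpM2l.
apply: le_trans JL _; rewrite [leRHS]mulrDl.
apply: ler_wpDl; first by rewrite mulr_ge0 // ltW.
apply: (@le_trans _ _ (CU * L)); last by rewrite -mulrA ler_wpM2l.
apply: ler_wpM2r => //; rewrite /CU lerDr addr_ge0 //.
by rewrite mulr_ge0.
Qed.

Unset Implicit Arguments.

Theorem lemma3p3 (R : realType) (d : nat) (Omega GammaD GammaN : set 'rV[R]_d)
    (sigma tau : R) :
  (d = 2 \/ d = 3)%N ->
  polyhedral_domain Omega ->
  GammaD `|` GammaN = bdry Omega ->
  (forall mu1 mu2 mu lambda alpha0 : R,
     0 < mu1 -> mu1 < mu -> mu < mu2 -> 0 <= lambda -> 1 <= alpha0 ->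
   exists2 C : R, 0 < C &
   forall M : mesh R d,
     mesh_of M Omega GammaD GammaN -> shape_regular M sigma ->
     stable M GammaD lambda mu alpha0 ->
   forall z : field M, Zspace GammaN z ->
     (hmesh M) ^- 2 * (L2norm z) ^+ 2 <= C * A0 GammaD lambda mu alpha0 z z
     /\ (quasi_uniform M tau ->
         A0 GammaD lambda mu alpha0 z z
           <= C * ((hmesh M) ^- 2 * (L2norm z) ^+ 2)))
  /\
  (exists2 C : R, 0 < C &
   forall mu1 mu2 mu lambda alpha0 alpha1 : R,
     0 < mu1 -> mu1 < mu -> mu < mu2 -> 0 <= lambda -> 1 <= alpha0 ->
     0 < alpha1 ->
   forall M : mesh R d,
     mesh_of M Omega GammaD GammaN -> shape_regular M sigma ->
     stable M GammaD lambda mu alpha0 ->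
   forall z : field M, Zspace GammaN z ->
     (alpha0 * beta0 d lambda mu + alpha1 * beta1 mu)
         * (hmesh M) ^- 2 * (L2norm z) ^+ 2
       <= C * Afull GammaD lambda mu alpha0 alpha1 z z
     /\ (quasi_uniform M tau ->
         Afull GammaD lambda mu alpha0 alpha1 z z
           <= C * ((alpha0 * beta0 d lambda mu + alpha1 * beta1 mu)
                    * (hmesh M) ^- 2 * (L2norm z) ^+ 2))).
Proof.
move=> d23 _ _.
have [n n0 dn] : exists2 n, (0 < n)%N & d = n.+1.
  by case: d23 => ->; [exists 1%N|exists 2%N].
subst d; have [C C0 HC] := form_bounds sigma tau n0; split.
  move=> mu1 mu2 mu lambda alpha0 mu1_0 mu1_mu _ l0 a0.
  have m0 : 0 < mu by apply: lt_trans mu1_mu.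
  have ab0 : 0 < alpha0 * beta0 n.+1 lambda mu.
    by apply: mulr_gt0; [exact: lt_le_trans a0|exact: beta0_gt0].
  set ab := alpha0 * _ in ab0.
  (* [C / ab] is for the lower and [C * ab] for the upper bound; the parameters, fixed before the
     constant here, may enter it. *)
  exists (C / ab + C * ab); first by rewrite addr_gt0 // ?divr_gt0 // mulr_gt0.
  move=> M HM HS st z zZ.
  have [lo _ up] := HC _ _ _ _ _ _ m0 l0 a0 M HM HS st z zZ.
  move: lo up; cbv zeta; rewrite -/ab; set X := _ ^- 2 * _; set A := A0 _ _ _ _ _ _.
  move=> lo up.
  have X0 : 0 <= X by rewrite mulr_ge0 ?sqr_ge0 // invr_ge0 sqr_ge0.
  have A_ge0 : 0 <= A.
    by rewrite -(pmulr_rge0 _ C0); apply: le_trans lo; rewrite mulr_ge0 // ltW.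
  split.
    rewrite mulrDl; apply: ler_wpDr; first by rewrite mulr_ge0 // ltW // mulr_gt0.
    by rewrite mulrAC ler_pdivlMr // mulrC.
  move=> /up[le1 _]; apply: le_trans le1 _.
  by rewrite mulrDl mulrA; apply: ler_wpDl => //; rewrite mulr_ge0 // divr_ge0 // ltW.
exists C => // mu1 mu2 mu lambda alpha0 alpha1 mu1_0 mu1_mu _ l0 a0 a1.
have m0 : 0 < mu by apply: lt_trans mu1_mu.
move=> M HM HS st z zZ.
have [lo lo1 up] := HC _ _ _ _ _ _ m0 l0 a0 M HM HS st z zZ.
move: lo lo1 up; cbv zeta.
set X := _ ^- 2 * _; set J := \sum_(E in _) _; set A := A0 _ _ _ _ _ _.
set ab := alpha0 * _ => lo lo1 up; pose ab1 := alpha1 * beta1 mu.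
have ab10 : 0 < ab1 by rewrite !mulr_gt0.
(* [A] compares with [ab * X] and [J] with [X]; weighting the latter by [ab1] and adding gives the
   factor [ab + ab1] with the same [C]. *)
have -> : Afull GammaD lambda mu alpha0 alpha1 z z = A + ab1 * J by [].
rewrite -[_ * _ ^- 2 * _]mulrA -/X -/ab1.
rewrite (mulrDl ab ab1 X) (mulrDr C A) (mulrDr C (ab * X)).
split; first by rewrite lerD // [leRHS]mulrCA ler_pM2l.
by move=> /up[le1 le2]; rewrite lerD // [leRHS]mulrCA ler_pM2l.
Qed.
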